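(* Let $k \ge 1$ be a fixed natural number. Then there exist a constant $c_k > 0$ and a number $q_0(k)$, both depending only on $k$, such that for all primes $q \ge q_0(k)$, $$ \sum_{\substack{\chi \pmod q \\ \chi \neq \chi_0}} \left|L(\tfrac12,\chi)\right|^{2k} \ \ge\ c_k\, q(\log q)^{k^2}. $$
   Context: The sum runs over all Dirichlet characters $\chi$ modulo $q$ other than the principal character $\chi_0$ modulo $q$. $L(s,\chi)$ denotes the Dirichlet $L$-function of $\chi$, given by $\sum_{n\ge 1}\chi(n)n^{-s}$ for $\mathrm{Re}(s)>1$ and by analytic continuation elsewhere; $L(\tfrac12,\chi)$ is its value at the central point $s=\tfrac12$. *)

(* Defs.v *)
From mathcomp Require Import all_boot all_order all_algebra.
From mathcomp Require Import complex.
From mathcomp Require Import all_classical all_reals all_analysis.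

Set Implicit Arguments.
Unset Strict Implicit.
Unset Printing Implicit Defensive.

Import Order.TTheory GRing.Theory Num.Theory.
Import numFieldNormedType.Exports.

Local Open Scope classical_set_scope.
Local Open Scope ring_scope.
Local Open Scope complex_scope.

(* The alias [^o] is what gives [R[i]] its norm topology. *)
Notation Cplx R := (R[i]^o).

Definition cexp (R : realType) (z : Cplx R) : Cplx R :=
  (expR (complex.Re z))%:C *
  (cos (complex.Im z) +i* sin (complex.Im z)).

Definition cmod (R : realType) (z : Cplx R) : R :=
  ComplexField.Normc.normc z.

(* n ^ (- s) for n >= 1, with the real logarithm of n; the value at n = 0 is
   junk and is never used. *)
Definition npowN (R : realType) (n : nat) (s : Cplx R) : Cplx R :=
  cexp (- s * (ln n%:R)%:C).

(* A periodic function on the integers is determined by its values on [nat].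
   [chi 1 = 1] follows from multiplicativity and [chi 1 != 0]. *)
Definition dirichlet_char (R : realType) (q : nat) : set (nat -> Cplx R) :=
  [set chi | [/\ forall n, chi (n + q)%N = chi n,
                 forall m n, chi (m * n)%N = chi m * chi n
               & forall n, (chi n != 0) = coprime n q]].
Arguments dirichlet_char : clear implicits.

Definition principal_char (R : realType) (q : nat) : nat -> Cplx R :=
  fun n => (coprime n q)%:R.
Arguments principal_char : clear implicits.

Definition analytic_at (R : realType) (f : Cplx R -> Cplx R) (z : Cplx R) :=
  exists a : nat -> Cplx R, \forall w \near z,
    series (fun n => a n * (w - z) ^+ n) @ \oo --> f w.

(* The index is shifted so that the sum runs over n >= 1. *)
Definition dirichlet_series_to (R : realType) (chi : nat -> Cplx R)
    (s v : Cplx R) : Prop :=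
  series (fun n => chi n.+1 * npowN n.+1 s) @ \oo --> v.

Definition dirichletL_continuation (R : realType) (chi : nat -> Cplx R)
    (U : set (Cplx R)) (f : Cplx R -> Cplx R) : Prop :=
  [/\ open U, connected U, [set s | 1 < complex.Re s] `<=` U,
      forall s, U s -> analytic_at f s
    & forall s, 1 < complex.Re s -> dirichlet_series_to chi s (f s)].

(* Since U is connected, f is determined on U by the Dirichlet series; and
   since the L-function of a Dirichlet character is meromorphic on the plane,
   the value at s depends on neither U nor f. It is 0 by convention when there
   is no continuation to s (the principal character at s = 1). *)
Definition dirichletL (R : realType) (chi : nat -> Cplx R) (s : Cplx R) :
    Cplx R :=
  xget 0 [set v | exists U f,
    [/\ dirichletL_continuation chi U f, U s & f s = v]].

(* Main.v *)
Require Import Defs.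
From mathcomp Require Import all_boot all_order all_algebra.
From mathcomp Require Import all_field cyclic.
From mathcomp Require Import complex.
From mathcomp Require Import all_classical all_reals all_analysis.
From mathcomp Require Import ring lra zify.

Set Implicit Arguments.
Unset Strict Implicit.
Unset Printing Implicit Defensive.

Import Order.TTheory GRing.Theory Num.Theory.
Import numFieldNormedType.Exports.

Local Open Scope classical_set_scope.
Local Open Scope ring_scope.
Local Open Scope complex_scope.

(** The proof is a resonance argument. Let [A chi] be the sum of
    [chi n / sqrt n] over [n <= Y], where [Y] is a small power of [q], and compare
      [S1 = \sum_(chi != chi_0) L (1/2, chi) * A chi ^ (k - 1) * conj (A chi) ^ k]
    with [S2 = \sum_chi |A chi| ^ (2 k)]. By orthogonality of characters and since
    [Y ^ k < q], [S2] is exactly [(q - 1) * energy k Y], where [energy k Y] is the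
    sum of [1 / (m_1 ... m_k)] over the solutions of [m_1 ... m_k = l_1 ... l_k]
    in [[1, Y]] ([short_moment]).

    The central value is the limit of the sums of [chi n / sqrt n] over
    [n <= J * q] ([dirichletL_cvg]). Expanding [S1], each [(m, l)] contributes,
    up to its weight, [q - 1] times the sum of [1 / sqrt n] over the [n] with
    [n * m = l] modulo [q], minus [q - 1] times the average of such sums over all
    invertible classes. The [n <= Y] with
    [n * m = l] rebuild [(q - 1) * energy k Y]; as [1 / sqrt n] decreases, all the
    other terms together are at least [- 3 * sqrt q], uniformly in [J]
    ([class_defect_sum_ge]). So [S1] is at least [S2] up to an error that is
    negligible because [Y] is small ([mixed_moment_ge]). The pointwise inequality
    [a * b ^ m <= 4 ^ m * a ^ (m + 1) + b ^ (m + 1) / 4] with [m = 2 k - 1] then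
    bounds the moment below by a constant multiple of [q * energy k Y]
    ([moment_ge_energy]).

    The energy is at least of order [ln Y ^ (k ^ 2)]: pairwise coprime [k * k]
    arrays give distinct solutions through their row and column products
    ([energy_ge_coprime]), and if the entries avoid small prime factors then a
    positive proportion of all arrays is pairwise coprime
    ([sum_pairwise_coprime]).

    The value [dirichletL chi s] is an arbitrary choice among the values of
    analytic continuations along connected domains, so one has to show that
    those values agree. The L-function of a non-principal character is therefore
    continued to the whole plane, as a single power series centred at 2
    ([periodic_dirichlet_entire]): repeated summation by parts replaces the
    coefficients by iterated differences, which are small by the mean value
    theorem. Any continuation then agrees with it by the identity theorem. *)

(** * Complex modulus and convergence *)

Section ComplexModulus.
Context {R : realType}.
Implicit Types z w : Cplx R.

Lemma normrE_cmod z : `|z| = (cmod z)%:C.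
Proof. by case: z. Qed.

Lemma cmod_ge0 z : 0 <= cmod z.
Proof. by case: z => a b; apply: sqrtr_ge0. Qed.

Lemma cmodM z w : cmod (z * w) = cmod z * cmod w.
Proof. exact: ComplexField.Normc.normcM. Qed.

Lemma cmodD z w : cmod (z + w) <= cmod z + cmod w.
Proof. by have := ler_normD z w; rewrite !normrE_cmod -rmorphD lecR. Qed.

Lemma cmodN z : cmod (- z) = cmod z.
Proof. by have := normrN z; rewrite !normrE_cmod => /complexI. Qed.

Lemma cmodB z w : cmod (z - w) = cmod (w - z).
Proof. by rewrite -cmodN opprB. Qed.

Lemma cmod_dist z w : `|cmod z - cmod w| <= cmod (z - w).
Proof.
rewrite ler_norml; apply/andP; split.
  rewrite lerBrDl lerBlDr cmodB; apply: le_trans (cmodD _ _).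
  by rewrite addrC subrK.
by rewrite lerBlDr; apply: le_trans (cmodD _ _); rewrite subrK.
Qed.

Lemma cmod0 : cmod (0 : Cplx R) = 0.
Proof. exact: ComplexField.Normc.normc0. Qed.

Lemma cmod1 : cmod (1 : Cplx R) = 1.
Proof. exact: ComplexField.Normc.normc1. Qed.

Lemma cmod_eq0 z : (cmod z == 0) = (z == 0).
Proof.
apply/eqP/eqP => [|->]; last exact: cmod0.
exact: ComplexField.Normc.eq0_normc.
Qed.

Lemma cmodX z n : cmod (z ^+ n) = cmod z ^+ n.
Proof.
by elim: n => [|n ih]; rewrite ?expr0 ?cmod1 // !exprS cmodM ih.
Qed.

Lemma cmod_real (x : R) : cmod (x%:C : Cplx R) = `|x|.
Proof. by rewrite /cmod /= expr0n /= addr0 sqrtr_sqr. Qed.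

Lemma cmod_conj z : cmod z^* = cmod z.
Proof. by have := normcJ z; rewrite !normrE_cmod => /complexI. Qed.

Lemma cmod_sum I (s : seq I) (P : pred I) (F : I -> Cplx R) :
  cmod (\sum_(i <- s | P i) F i) <= \sum_(i <- s | P i) cmod (F i).
Proof.
elim/big_rec2: _ => [|i x y _ le_yx]; first by rewrite cmod0.
by apply: le_trans (cmodD _ _) _; rewrite lerD2l.
Qed.

Lemma Re_le_cmod z : `|complex.Re z| <= cmod z.
Proof. by have := normc_ge_Re z; rewrite normrE_cmod lecR. Qed.

Lemma Im_le_cmod z : `|complex.Im z| <= cmod z.
Proof.
case: z => a b; rewrite /cmod /= -sqrtr_sqr ler_sqrt ?lerDr ?sqr_ge0 //.
by rewrite addr_ge0 ?sqr_ge0.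
Qed.

Lemma cmod_le_ReIm z : cmod z <= `|complex.Re z| + `|complex.Im z|.
Proof.
rewrite [X in cmod X <= _]complexE.
apply: le_trans (cmodD _ _) _; rewrite cmodM !cmod_real.
have -> : cmod ('i : Cplx R) = 1 by rewrite /cmod /= expr0n /= expr1n add0r sqrtr1.
by rewrite mul1r.
Qed.

Lemma ReD z w : complex.Re (z + w) = complex.Re z + complex.Re w.
Proof. by case: z; case: w. Qed.

Lemma ImD z w : complex.Im (z + w) = complex.Im z + complex.Im w.
Proof. by case: z; case: w. Qed.

Lemma ReN z : complex.Re (- z) = - complex.Re z.
Proof. by case: z. Qed.

Lemma ImN z : complex.Im (- z) = - complex.Im z.
Proof. by case: z. Qed.

Lemma Re_sum I (s : seq I) (P : pred I) (F : I -> Cplx R) :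
  complex.Re (\sum_(i <- s | P i) F i) = \sum_(i <- s | P i) complex.Re (F i).
Proof. by elim/big_rec2: _ => [|i x y _ <-] //; rewrite ReD. Qed.

Lemma Im_sum I (s : seq I) (P : pred I) (F : I -> Cplx R) :
  complex.Im (\sum_(i <- s | P i) F i) = \sum_(i <- s | P i) complex.Im (F i).
Proof. by elim/big_rec2: _ => [|i x y _ <-] //; rewrite ImD. Qed.

Lemma Re_realM (x : R) z : complex.Re (x%:C * z) = x * complex.Re z.
Proof. by case: z => a b /=; rewrite mul0r subr0. Qed.

Lemma Im_realM (x : R) z : complex.Im (x%:C * z) = x * complex.Im z.
Proof. by case: z => a b /=; rewrite mul0r addr0. Qed.

(** The filters of neighbourhoods in [Cplx R] are stated with the
    complex-valued norm; this brings them back to real inequalities. *)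
Lemma ccvgP T (F : set_system T) {FF : Filter F} (u : T -> Cplx R) (v : Cplx R) :
  u @ F --> v <-> (fun t => cmod (u t - v)) @ F --> (0 : R).
Proof.
rewrite !cvgrPdist_lt; split => H e e0.
  have := H e%:C; rewrite ltcR => /(_ e0); apply: filterS => t.
  rewrite normrE_cmod ltcR cmodB sub0r normrN ger0_norm //.
  exact: cmod_ge0.
case: e e0 => a b; rewrite ltcE /= => /andP[/eqP -> a0].
have := H a a0; apply: filterS => t.
rewrite sub0r normrN ger0_norm ?cmod_ge0// => ltv.
by rewrite normrE_cmod ltcR cmodB.
Qed.

Lemma ccvg_le T (F : set_system T) {FF : Filter F} (u : T -> Cplx R) (v : Cplx R) (e : T -> R) :
  (\forall t \near F, cmod (u t - v) <= e t) -> e @ F --> (0 : R) -> u @ F --> v.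
Proof.
move=> le_e e0; apply/ccvgP; apply: (squeeze_cvgr _ (cvg_cst 0) e0).
by apply: filterS le_e => t ->; rewrite cmod_ge0.
Qed.

Lemma ccvg_Re T (F : set_system T) {FF : Filter F} (u : T -> Cplx R) (v : Cplx R) :
  u @ F --> v -> (fun t => complex.Re (u t)) @ F --> complex.Re v.
Proof.
move=> /ccvgP u_v; apply/cvgrPdist_le => e e0.
move/cvgrPdist_le: u_v => /(_ e e0); apply: filterS => t.
rewrite sub0r normrN ger0_norm ?cmod_ge0//; apply: le_trans.
by rewrite distrC -ReN -ReD Re_le_cmod.
Qed.

Lemma ccvg_cmod T (F : set_system T) {FF : Filter F} (u : T -> Cplx R) (v : Cplx R) :
  u @ F --> v -> (fun t => cmod (u t)) @ F --> cmod v.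
Proof.
move=> /ccvgP u_v; apply/cvgrPdist_le => e e0.
move/cvgrPdist_le: u_v => /(_ e e0); apply: filterS => t.
rewrite sub0r normrN ger0_norm ?cmod_ge0//; apply: le_trans.
by rewrite distrC cmod_dist.
Qed.

Lemma ccvg_ReIm T (F : set_system T) {FF : Filter F} (u : T -> Cplx R) (v : Cplx R) :
  (fun t => complex.Re (u t)) @ F --> complex.Re v ->
  (fun t => complex.Im (u t)) @ F --> complex.Im v -> u @ F --> v.
Proof.
move=> Rv Iv; apply: (@ccvg_le _ _ _ _ _
  (fun t => `|complex.Re (u t) - complex.Re v| + `|complex.Im (u t) - complex.Im v|)).
  apply: nearW => t; apply: le_trans (cmod_le_ReIm _) _.
  by rewrite ReD ReN ImD ImN.
rewrite -[0 in X in _ --> X](addr0 0).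
apply: cvgD; rewrite -[0 in X in _ --> X](@normr0 _ R); apply: cvg_norm.
  by apply/subr_cvg0.
by apply/subr_cvg0.
Qed.

Lemma ccvgB (u v : nat -> Cplx R) (a b : Cplx R) :
  u @ \oo --> a -> v @ \oo --> b -> (fun n => u n - v n) @ \oo --> (a - b : Cplx R).
Proof. by move=> ua vb; apply: cvgB; [exact: ua | exact: vb]. Qed.

Lemma ccvgMr (u : nat -> Cplx R) (c a : Cplx R) :
  u @ \oo --> a -> (fun n => c * u n) @ \oo --> (c * a : Cplx R).
Proof. by move=> ua; apply: cvgM; [exact: cvg_cst | exact: ua]. Qed.

Lemma ccvg_unique (u : nat -> Cplx R) (v w : Cplx R) :
  u @ \oo --> v -> u @ \oo --> w -> v = w.
Proof. by move=> uv uw; apply: cvg_unique uv uw. Qed.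

(** Absolute convergence implies convergence; the remainder after [N] terms
    is at most the remainder of the majorant. *)
Lemma cseries_dominated (u : nat -> Cplx R) (t : nat -> R) :
  (forall n, cmod (u n) <= t n) -> cvgn (series t) ->
  exists2 v : Cplx R, series u @ \oo --> v &
    forall N, cmod (v - series u N) <= limn (series t) - series t N.
Proof.
move=> le_ut cvt.
have t0 n : 0 <= t n := le_trans (cmod_ge0 _) (le_ut n).
have cvgpart (f : Cplx R -> R) : (forall z, `|f z| <= cmod z) ->
    cvgn (series (fun n => f (u n))).
  move=> le_f; apply: normed_cvg; apply: series_le_cvg cvt => [n|//|n] /=.
    exact: normr_ge0.
  exact: le_trans (le_f _) (le_ut n).
have cvR := cvgpart (@complex.Re R) Re_le_cmod.
have cvI := cvgpart (@complex.Im R) Im_le_cmod.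
pose v : Cplx R := Complex (limn (series (fun n => complex.Re (u n))))
                       (limn (series (fun n => complex.Im (u n)))).
have uv : series u @ \oo --> v.
  apply: ccvg_ReIm; rewrite /=.
    by under eq_fun do rewrite /series/= Re_sum.
  by under eq_fun do rewrite /series/= Im_sum.
exists v => // N.
have cvN : (fun n => cmod (series u n - series u N)) @ \oo --> cmod (v - series u N).
  exact: ccvg_cmod (cvgB uv (cvg_cst _)).
apply: (@ler_cvg_to _ _ _ _ _ _ _ _ cvN (cvgB cvt (cvg_cst (series t N)))).
near=> n.
have leNn : (N <= n)%N by near: n; exact: nbhs_infty_ge.
have -> : (series t - cst (series t N)) n = series t n - series t N by [].
rewrite !sub_series leNn.
by apply: le_trans (cmod_sum _ _ _) _; apply: ler_sum.
Unshelve. all: by end_near.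
Qed.

End ComplexModulus.

(** * Power series *)

Section PowerSeries.
Context {R : realType}.
Implicit Types (z w h : Cplx R) (c : nat -> Cplx R) (rho r : R).

Lemma ccvg_sum I (s : seq I) (P : pred I) (f : I -> nat -> Cplx R) (l : I -> Cplx R) :
  (forall i, P i -> f i @ \oo --> l i) ->
  (fun n => \sum_(i <- s | P i) f i n) @ \oo --> \sum_(i <- s | P i) l i.
Proof.
move=> fl; elim: s => [|i s ih].
  rewrite big_nil; under eq_fun do rewrite big_nil; exact: cvg_cst.
rewrite big_cons; under eq_fun do rewrite big_cons.
by case: ifP => [Pi|_]; [exact: (cvgD (fl i Pi) ih) | exact: ih].
Qed.

(** For each [i] the tail of the sum over [n] is at most [rho ^- i] times the tail
    of [t]; so the tail of the double series is at most the tail of [t] times a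
    geometric series in [cmod h / rho], and the sums can be interchanged. This
    serves both for the Taylor expansion of a power series at another point and
    for the summation of a family of power series. *)
Lemma swap_series (u : nat -> nat -> Cplx R) (t : nat -> R) rho :
    0 < rho -> (forall n i, cmod (u n i) * rho ^+ i <= t n) ->
    cvgn (series t) ->
  exists c : nat -> Cplx R,
  [/\ forall i, series (fun n => u n i) @ \oo --> c i,
      forall i, cmod (c i) * rho ^+ i <= limn (series t)
    & forall h (E : nat -> Cplx R), cmod h < rho ->
       (forall n, series (fun i => u n i * h ^+ i) @ \oo --> E n) ->
       exists2 v : Cplx R, series (fun i => c i * h ^+ i) @ \oo --> v &
                  series E @ \oo --> v].
Proof.
move=> rho0 ut cvt.
have rhoX i : 0 < rho ^+ i by rewrite exprn_gt0.
have dom i n : cmod (u n i) <= t n * rho ^- i by rewrite ler_pdivlMr.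
have cvti i : series (fun n => t n * rho ^- i) @ \oo --> limn (series t) * rho ^- i.
  have -> : series (fun n => t n * rho ^- i) = (fun N => series t N * rho ^- i).
    by apply/funext => N; rewrite /series /= mulr_suml.
  by apply: cvgM; [exact: cvt | exact: cvg_cst].
have /choice[c cP] i : exists v : Cplx R, series (fun n => u n i) @ \oo --> v /\
    forall N, cmod (v - series (fun n => u n i) N) <=
      (limn (series t) - series t N) * rho ^- i.
  have [v uv tail] := cseries_dominated (dom i) (cvgP _ (cvti i)).
  exists v; split=> // N; apply: le_trans (tail N) _.
  rewrite (cvg_lim _ (cvti i)) // mulrBl /series /= mulr_suml //.
pose T := limn (series t).
have cT i : cmod (c i) * rho ^+ i <= T.
  rewrite -ler_pdivlMr //; have [_ /(_ 0%N)] := cP i.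
  by rewrite /series /= !big_geq // !subr0.
exists c; split => // [i|h E hrho Eu]; first by case: (cP i).
pose x := cmod h / rho.
have x0 : 0 <= x by rewrite /x divr_ge0 ?cmod_ge0 // ltW.
have x1 : x < 1 by rewrite /x ltr_pdivrMr // mul1r.
have nx1 : `|x| < 1 by rewrite ger0_norm.
have [] := @cseries_dominated _ (fun i => c i * h ^+ i) (geometric T x).
- move=> i /=; rewrite cmodM cmodX /x expr_div_n mulrA mulrAC.
  by rewrite ler_wpM2r ?exprn_ge0 ?cmod_ge0 // ler_pdivlMr.
- exact: is_cvg_geometric_series.
move=> v cv _; exists v => //.
apply: (@ccvg_le _ _ _ _ _ _ (fun N => (T - series t N) * (1 - x)^-1)); last first.
  rewrite -(mul0r (1 - x)^-1) -(subrr T).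
  by apply: cvgM; [apply: cvgB => //; exact: cvg_cst | exact: cvg_cst].
apply: nearW => N.
have t0 n : 0 <= t n.
  by apply: le_trans (ut n 0%N); rewrite mulr_ge0 ?cmod_ge0 // exprn_ge0 // ltW.
have TN0 : 0 <= T - series t N.
  rewrite subr_ge0; apply: nondecreasing_cvgn_le => //.
  by apply: nondecreasing_series => n _ _; exact: t0.
pose D M : Cplx R := series (fun i => c i * h ^+ i) M -
  \sum_(0 <= n < N) series (fun i => u n i * h ^+ i) M.
have cvD : D @ \oo --> (v - series E N : Cplx R) 
  by apply: cvgB; [exact: cv | apply: ccvg_sum => i _; exact: Eu].
have cvD' : (fun M => cmod (D M)) @ \oo --> cmod (v - series E N).
  exact: ccvg_cmod cvD.
rewrite cmodB; apply: (ler_cvg_to cvD' (cvg_cst _)); apply: nearW => M.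
rewrite /D /series /= exchange_big /= -sumrB.
apply: le_trans (cmod_sum _ _ _) _.
apply: (@le_trans _ _ (series (geometric (T - series t N) x) M)).
  apply: ler_sum => i _ /=.
  rewrite -mulr_suml -mulrBl cmodM cmodX /x expr_div_n mulrA mulrAC.
  by rewrite ler_wpM2r ?exprn_ge0 ?cmod_ge0 //; exact: (cP i).2.
have [->|xn0] := eqVneq x 0; last by apply: geometric_le_lim => //; rewrite lt_def xn0.
rewrite subr0 invr1 mulr1 /series /=.
case: M => [|M]; first by rewrite big_geq.
rewrite big_nat_recl // expr0 mulr1 [X in _ + X]big1 ?addr0 // => i _.
by rewrite exprS mul0r mulr0.
Qed.

(** Coefficients of a power series with infinite radius of convergence. *)
Definition entire_coef c :=
  forall r : R, 0 < r -> exists B, forall i, cmod (c i) * r ^+ i <= B.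

Lemma pseries_dominated c r B h : 0 < r -> cmod h < r ->
  (forall i, cmod (c i) * r ^+ i <= B) ->
  exists2 v : Cplx R, series (fun i => c i * h ^+ i) @ \oo --> v &
    forall N, cmod (v - series (fun i => c i * h ^+ i) N) <=
      B * (cmod h / r) ^+ N / (1 - cmod h / r).
Proof.
move=> r0 hr cB; set x := cmod h / r.
have x0 : 0 <= x by rewrite /x divr_ge0 ?cmod_ge0 // ltW.
have x1 : x < 1 by rewrite /x ltr_pdivrMr // mul1r.
have nx1 : `|x| < 1 by rewrite ger0_norm.
have [] := @cseries_dominated _ (fun i => c i * h ^+ i) (geometric B x).
- move=> i /=; rewrite cmodM cmodX /x expr_div_n mulrA mulrAC.
  by rewrite ler_wpM2r ?exprn_ge0 ?cmod_ge0 // ler_pdivlMr ?exprn_gt0.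
- exact: is_cvg_geometric_series.
move=> v cv tail; exists v => // N; apply: le_trans (tail N) _.
have x1' : x != 1 by rewrite lt_eqF.
rewrite (cvg_lim _ (cvg_geometric_series nx1)) // geometric_seriesE //=.
rewrite le_eqVlt; apply/orP; left; apply/eqP.
have : 1 - x != 0 by rewrite subr_eq0 eq_sym.
by move=> x10; field.
Qed.

Lemma entire_cvg c : entire_coef c -> forall h,
  exists v : Cplx R, series (fun i => c i * h ^+ i) @ \oo --> v.
Proof.
move=> ec h.
have r0 : 0 < cmod h + 1 by rewrite ltr_wpDl ?cmod_ge0.
have [B cB] := ec _ r0.
have hr : cmod h < cmod h + 1 by rewrite ltrDl.
by have [v cv _] := pseries_dominated r0 hr cB; exists v.
Qed.

(** Expand [(w0 + h) ^+ n] by the binomial formula and interchange the sums. The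
    coefficients are given explicitly because, for the exponential series, they
    identify the expansion at [w0] as a multiple of the expansion at 0. *)
Lemma entire_recenter c (F : Cplx R -> Cplx R) w0 : entire_coef c ->
    (forall w, series (fun i => c i * w ^+ i) @ \oo --> F w) ->
  exists b : nat -> Cplx R,
  [/\ forall i, series (fun n => c n * ('C(n, i)%:R * w0 ^+ (n - i))) @ \oo --> b i,
      entire_coef b
    & forall h, series (fun i => b i * h ^+ i) @ \oo --> F (w0 + h)].
Proof.
move=> ec cF.
pose u n i : Cplx R := c n * ('C(n, i)%:R * w0 ^+ (n - i)).
have key rho : 0 < rho -> exists b : nat -> Cplx R,
  [/\ forall i, series (fun n => u n i) @ \oo --> b i,
   exists B, forall i, cmod (b i) * rho ^+ i <= B &
   forall h, cmod h < rho -> series (fun i => b i * h ^+ i) @ \oo --> F (w0 + h)].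
  move=> rho0; pose s := cmod w0 + rho.
  have s0 : 0 < s by rewrite /s ltr_wpDl ?cmod_ge0.
  have [|B cB] := ec (2 * s); first by rewrite mulr_gt0.
  have ut n i : cmod (u n i) * rho ^+ i <= cmod (c n) * s ^+ n.
    rewrite /u cmodM -mulrA ler_wpM2l ?cmod_ge0 //.
    have [lt_ni|le_in] := ltnP n i.
      by rewrite bin_small // mul0r cmod0 mul0r exprn_ge0 // ltW.
    rewrite /s exprDn (bigD1 (inord i)) //= inordK ?ltnS //.
    rewrite cmodM cmodX; have -> : cmod ('C(n, i)%:R : Cplx R) = 'C(n, i)%:R.
      by rewrite -(rmorph_nat (real_complex R)) cmod_real ger0_norm.
    rewrite -[X in _ <= X + _]mulr_natl -mulrA lerDl sumr_ge0 // => j _.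
    by rewrite mulrn_wge0 // mulr_ge0 // exprn_ge0 ?cmod_ge0 // ltW.
  have cvt : cvgn (series (fun n => cmod (c n) * s ^+ n)).
    have g2 : cvgn (series (geometric B (2^-1))).
      by apply: is_cvg_geometric_series; rewrite ger0_norm ?invr_ge0 // invf_lt1 ?ltr1n.
    apply: series_le_cvg g2 => n /=.
    - by rewrite mulr_ge0 ?cmod_ge0 // exprn_ge0 // ltW.
    - rewrite mulr_ge0 ?exprn_ge0 ?invr_ge0 //.
      by apply: le_trans (cB 0%N); rewrite mulr_ge0 ?cmod_ge0.
    - by rewrite exprVn ler_pdivlMr ?exprn_gt0 // -mulrA -exprMn mulrC [s * 2]mulrC mulrC.
  have [b [bu bB bE]] := swap_series rho0 ut cvt.
  exists b; split => //; first by eexists; exact: bB.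
  move=> h hrho.
  have [|v bv Ev] := bE h (fun n => c n * (w0 + h) ^+ n) hrho.
    move=> n; apply: (@cvg_near_cst _ _ _ _ _ _).
    exists n.+1 => // m /= lt_nm.
    rewrite /series /= (big_cat_nat (leq0n n.+1) lt_nm) /= [X in _ + X]big1_seq ?addr0.
      rewrite big_mkord exprDn mulr_sumr; apply: eq_bigr => i _.
      by rewrite /u -mulr_natl; ring.
    move=> i /andP[_]; rewrite mem_index_iota => /andP[lt_ni _].
    by rewrite /u bin_small // mul0r mulr0 mul0r.
  by have -> : F (w0 + h) = v by apply: cvg_unique (cF _) Ev.
have [b [bu _ _]] := key 1 ltr01.
(* The coefficients produced by [key] depend on [rho] in appearance only. *)
have same b' : (forall i, series (fun n => u n i) @ \oo --> b' i) -> b' = b.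
  by move=> b'u; apply/funext => i; apply: cvg_unique (b'u i) (bu i).
exists b; split; first exact: bu.
  by move=> r r0; have [b' [/same <- bB _]] := key r r0.
move=> h; have h0 : 0 < cmod h + 1 by rewrite ltr_wpDl ?cmod_ge0.
by have [b' [/same <- _ bF]] := key _ h0; apply: bF; rewrite ltrDl.
Qed.

End PowerSeries.

(** * The complex exponential *)

Section ComplexExponential.
Context {R : realType}.
Implicit Types (z w h s : Cplx R).

Lemma expr_fact_le (x : R) n : 0 <= x -> x ^+ n / n`!%:R <= expR x.
Proof.
move=> x0; case: n => [|n].
  by rewrite expr0 fact0 divr1; apply: le_trans (expR_ge1Dx x); rewrite lerDl.
by apply: le_trans (expR_ge1Dxn n x0); rewrite lerDr.
Qed.

Lemma ccvg_real T (F : set_system T) {FF : Filter F} (u : T -> R) (l : R) :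
  u @ F --> l -> (fun t => (u t)%:C : Cplx R) @ F --> (l%:C : Cplx R).
Proof.
move=> ul; apply: ccvg_ReIm => //=; exact: cvg_cst.
Qed.

Lemma natrC n : (n%:R : Cplx R) = (n%:R : R)%:C.
Proof. by rewrite rmorph_nat. Qed.

Lemma inv_factC n : ((n`!%:R)^-1 : Cplx R) = ((n`!%:R)^-1 : R)%:C.
Proof. by rewrite fmorphV rmorph_nat. Qed.

Lemma entire_inv_fact : entire_coef (fun n => (n`!%:R)^-1 : Cplx R).
Proof.
move=> r r0; exists (expR r) => i.
rewrite inv_factC cmod_real ger0_norm ?invr_ge0 // mulrC.
exact/expr_fact_le/ltW.
Qed.

(** Only the values on the real and on the imaginary axis have to be compared
    with [expR], [cos] and [sin]: the exponential series is multiplicative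
    because its Taylor expansion at [z] has the coefficients of the series at 0,
    multiplied by its value at [z]. *)
Lemma cexp_series z :
  series (fun n => (n`!%:R)^-1 * z ^+ n) @ \oo --> cexp z.
Proof.
have /choice[F FE] : forall w, exists v : Cplx R,
    series (fun n => (n`!%:R)^-1 * w ^+ n) @ \oo --> v.
  exact: (entire_cvg entire_inv_fact).
have FD a b : F (a + b) = F a * F b.
  have [c [cE _ cF]] := entire_recenter a entire_inv_fact FE.
  have cFa i : c i = (i`!%:R)^-1 * F a.
    apply: (ccvg_unique (cE i)); rewrite -(cvg_shiftn i).
    have -> : [sequence series (fun n => (n`!%:R)^-1 *
        ('C(n, i)%:R * a ^+ (n - i))) (n + i)%N]_n =
        (fun N => (i`!%:R)^-1 * series (fun n => (n`!%:R)^-1 * a ^+ n) N).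
      apply/funext => N /=; rewrite /series /= addnC.
      rewrite (big_cat_nat (leq0n i) (leq_addr N i)) /= big1_seq ?add0r; last first.
        move=> j /andP[_]; rewrite mem_index_iota => /andP[_ ji].
        by rewrite bin_small // mul0r mulr0.
      rewrite -[X in \sum_(X <= _ < _) _]add0n big_addn addKn mulr_sumr; apply: eq_bigr => j _.
      rewrite addnK !mulrA; congr (_ * _).
      have fn0 m : (m`!%:R : Cplx R) != 0 by rewrite pnatr_eq0 -lt0n fact_gt0.
      have := bin_fact (leq_addl j i); rewrite addnK => <-.
      rewrite !natrM; field.
      by rewrite !fn0 /= pnatr_eq0 -lt0n bin_gt0 leq_addl.
    by apply: cvgM; [exact: cvg_cst | exact: FE].
  apply: (ccvg_unique (cF b)).
  have -> : series (fun i => c i * b ^+ i) =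
      (fun N => F a * series (fun n => (n`!%:R)^-1 * b ^+ n) N).
    apply/funext => N; rewrite /series /= mulr_sumr.
    by apply: eq_bigr => i _; rewrite cFa; ring.
  by apply: cvgM; [exact: cvg_cst | exact: FE].
have Freal (x : R) : F x%:C = (expR x)%:C.
  apply: (ccvg_unique (FE _)).
  have -> : series (fun n => (n`!%:R)^-1 * (x%:C : Cplx R) ^+ n) =
      (fun N => (series (exp_coeff x) N)%:C).
    apply/funext => N; rewrite /series /= rmorph_sum; apply: eq_bigr => i _.
    by rewrite inv_factC -rmorphXn -rmorphM mulrC.
  apply: ccvg_real; exact: is_cvg_series_exp_coeff.
have iX n : ('i : Cplx R) ^+ n =
    ((~~ odd n)%:R * (-1) ^+ n./2 : R)%:C + 'i * ((odd n)%:R * (-1) ^+ n./2 : R)%:C.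
  rewrite -{1}[n]odd_double_half exprD -muln2 mulnC exprM sqr_i.
  have -> : (-1 : Cplx R) ^+ n./2 = ((-1) ^+ n./2 : R)%:C.
    by rewrite rmorphXn rmorphN1.
  case: (odd n); rewrite /= ?mul0r ?mul1r ?expr0 ?expr1 ?mul1r ?mulr0 ?addr0 //.
  by rewrite add0r.
have Fimag (y : R) : F ('i * y%:C) = (cos y +i* sin y).
  apply: (ccvg_unique (FE _)).
  have coefE n : (n`!%:R)^-1 * ('i * y%:C : Cplx R) ^+ n =
      Complex (cos_coeff y n) (sin_coeff y n).
    have yX : (y%:C : Cplx R) ^+ n = (y ^+ n)%:C by rewrite rmorphXn.
    rewrite exprMn iX inv_factC yX /cos_coeff /sin_coeff.
    apply/eqP; rewrite eq_complex /= !(mul0r, mul1r, mulr0, subr0, addr0, add0r, sub0r, oppr0).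
    have -> : (odd n)%:R * (-1) ^+ n.-1./2 = (odd n)%:R * (-1) ^+ n./2 :> R.
      case: (n) => [|m] /=; first by [].
      by rewrite uphalf_half; case: (odd m); rewrite /= ?mul0r.
    by rewrite -exprnP; apply/andP; split; apply/eqP; ring.
  apply: ccvg_ReIm.
    have -> : (fun N => complex.Re (series (fun n => (n`!%:R)^-1 * ('i * y%:C : Cplx R) ^+ n) N)) = series (cos_coeff y).
      by apply/funext => N; rewrite /series /= Re_sum; apply: eq_bigr => i _; rewrite coefE.
    rewrite /= unlock; exact: is_cvg_series_cos_coeff.
  have -> : (fun N => complex.Im (series (fun n => (n`!%:R)^-1 * ('i * y%:C : Cplx R) ^+ n) N)) = series (sin_coeff y).
    by apply/funext => N; rewrite /series /= Im_sum; apply: eq_bigr => i _; rewrite coefE.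
  rewrite /= unlock; exact: is_cvg_series_sin_coeff.
have -> : cexp z = F z by rewrite [in RHS](complexE z) FD Freal Fimag.
exact: FE.
Qed.

Lemma cexpD z w : cexp (z + w) = cexp z * cexp w.
Proof.
case: z w => a b [c d]; rewrite /cexp /= expRD cosD sinD.
rewrite rmorphM mulrACA; congr (_ * _).
by rewrite -[RHS]/(_ +i* _); congr (_ +i* _); rewrite addrC.
Qed.

Lemma cmod_cexp z : cmod (cexp z) = expR (complex.Re z).
Proof.
rewrite /cexp cmodM cmod_real ger0_norm ?expR_ge0 //.
by rewrite /cmod /= cos2Dsin2 sqrtr1 mulr1.
Qed.

Lemma cexp_real (x : R) : cexp (x%:C : Cplx R) = (expR x)%:C.
Proof. by rewrite /cexp /= cos0 sin0 mulr1. Qed.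

Lemma npowND n s w : npowN n (s + w) = npowN n s * npowN n w.
Proof. by rewrite /npowN opprD mulrDl cexpD. Qed.

Lemma cmod_npowN n s : cmod (npowN n s) = expR (- complex.Re s * ln n%:R).
Proof. by rewrite /npowN cmod_cexp mulrC Re_realM ReN mulrC. Qed.

Lemma npowN_real n (x : R) : npowN n (x%:C : Cplx R) = (expR (- x * ln n%:R))%:C.
Proof. by rewrite /npowN -rmorphN -rmorphM cexp_real. Qed.

Lemma npowN_half n : npowN n.+1 ((2^-1 : R)%:C : Cplx R) = ((Num.sqrt n.+1%:R)^-1)%:C.
Proof.
rewrite npowN_real mulNr expRN; congr (_ ^-1)%:C.
apply/esym/eqP; rewrite -(@eqrXn2 _ 2%N) ?sqrtr_ge0 ?expR_ge0 //.
by rewrite sqr_sqrtr // -expRM_natl mulVKf // lnK // posrE.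
Qed.

End ComplexExponential.

(** * Sums against periodic sequences of mean zero *)

Section PeriodicSums.
Context {R : realType}.
Variable q : nat.
Hypothesis q_gt0 : (0 < q)%N.
Implicit Types (a A : nat -> Cplx R) (g : nat -> nat -> R) (r : R).

Definition periodic_mean_zero a :=
  (forall n, a (n + q)%N = a n) /\ \sum_(0 <= i < q) a i = 0.

Lemma periodic_modn (T : Type) (a : nat -> T) n :
  (forall n, a (n + q)%N = a n) -> a n = a (n %% q)%N.
Proof.
move=> aq; rewrite {1}(divn_eq n q) addnC.
by elim: (n %/ q)%N => [|k ih]; rewrite ?mul0n ?addn0 // mulSn addnCA addnC aq.
Qed.

Lemma periodic_bounded a : (forall n, a (n + q)%N = a n) ->
  exists2 B, 0 <= B & forall n, cmod (a n) <= B.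
Proof.
move=> aq; exists (\sum_(0 <= i < q) cmod (a i)).
  by apply: sumr_ge0 => i _; exact: cmod_ge0.
move=> n; rewrite (periodic_modn n aq) big_mkord.
rewrite (bigD1 (Ordinal (ltn_pmod n q_gt0))) //= lerDl.
by apply: sumr_ge0 => i _; exact: cmod_ge0.
Qed.

Lemma mean_zero_shift a : periodic_mean_zero a ->
  periodic_mean_zero (fun n => a n.+1).
Proof.
move=> [aq a0]; split=> [n|]; first by rewrite -addSn aq.
move: a0; rewrite -(prednK q_gt0) big_nat_recl // big_nat_recr //=.
by rewrite -[in X in _ -> _ + X = _](add0n q.-1.+1) prednK // aq addrC.
Qed.

(** The partial sums are periodic because the mean is zero; subtracting their own
    mean makes the step repeatable. *)
Lemma mean_zero_antiderivative a : periodic_mean_zero a ->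
  exists2 A, periodic_mean_zero A & forall n, A n.+1 - A n = a n.
Proof.
move=> [aq a0]; pose P n := \sum_(0 <= i < n) a i.
have Pq n : P (n + q)%N = P n.
  elim: n => [|n ih]; first by rewrite add0n /P a0 big_geq.
  by rewrite addSn /P !big_nat_recr //= -/(P _) -/(P _) ih aq.
pose M : Cplx R := (\sum_(0 <= i < q) P i) / q%:R.
exists (fun n => P n - M).
  split=> [n|]; first by rewrite Pq.
  rewrite sumrB sumr_const_nat subn0 /M -[_ *+ q]mulr_natr divfK ?subrr //.
  by rewrite pnatr_eq0 -lt0n.
by move=> n; rewrite opprB addrA subrK /P big_nat_recr //= addrC addKr.
Qed.

(** Here [g j n] is to be read as the [j]-th Taylor coefficient of the [n]-th
    term [E n] of a series depending on the complex parameter [h]. The predicate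
    says that the sum of [a n * E n], for any periodic [a] of mean zero, is a power
    series with radius of convergence at least [r], even where the terms [E n]
    do not decrease fast enough to be summed absolutely. *)
Definition summable_periodic r g := forall a, periodic_mean_zero a ->
  exists c : nat -> Cplx R,
  [/\ forall j, series (fun n => a n * (g j n)%:C) @ \oo --> c j,
      exists B, forall j, cmod (c j) * r ^+ j <= B
    & forall h (E : nat -> Cplx R), cmod h < r ->
        (forall n, series (fun j => (g j n)%:C * h ^+ j) @ \oo --> E n) ->
        E @ \oo --> (0 : Cplx R) ->
        exists2 v : Cplx R, series (fun j => c j * h ^+ j) @ \oo --> v &
          series (fun n => a n * E n) @ \oo --> v].

Lemma cvg_series_inv_sqr : cvgn (series (fun n => (n.+1%:R ^+ 2)^-1 : R)).
Proof.
apply: nondecreasing_is_cvgn.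
  apply: nondecreasing_series => n _ _.
  by rewrite invr_ge0 exprn_ge0.
exists 2 => _ [N _ <-].
suff : series (fun n => (n.+1%:R ^+ 2)^-1 : R) N <= 2 * (1 - N.+1%:R^-1).
  move=> /le_trans; apply; rewrite -[leRHS]mulr1 ler_wpM2l // lerBlDr lerDl.
elim: N => [|N ih]; first by rewrite /series /= big_geq // invr1 subrr mulr0.
rewrite /series /= big_nat_recr //=; apply: le_trans (lerD ih (lexx _)) _.
have n1 : (N.+1%:R : R) != 0 by rewrite pnatr_eq0.
have n2 : (N.+2%:R : R) != 0 by rewrite pnatr_eq0.
rewrite -subr_ge0.
have -> : 2 * (1 - N.+2%:R^-1) - (2 * (1 - N.+1%:R^-1) + (N.+1%:R ^+ 2)^-1)
   = N%:R / (N.+1%:R ^+ 2 * N.+2%:R) :> R.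
  by move: n1 n2; rewrite -[N.+2%:R]natr1 -[N.+1%:R]natr1 => n1 n2; field; rewrite n1 n2.
by rewrite divr_ge0 // mulr_ge0 // exprn_ge0.
Qed.

Lemma summable_periodic_abs r g (C : R) : 0 < r ->
  (forall j n, `|g j n| * r ^+ j <= C / n.+1%:R ^+ 2) -> summable_periodic r g.
Proof.
move=> r0 gC a [aq _]; have [B B0 aB] := periodic_bounded aq.
have ut n j : cmod (a n * (g j n)%:C) * r ^+ j <= B * C * (n.+1%:R ^+ 2)^-1.
  rewrite cmodM cmod_real -!mulrA ler_pM ?cmod_ge0 //.
  by rewrite mulr_ge0 // exprn_ge0 // ltW.
have cvt : cvgn (series (fun n => B * C * (n.+1%:R ^+ 2)^-1 : R)).
  exact: is_cvg_seriesZ cvg_series_inv_sqr.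
have [c [cE cB cF]] := swap_series r0 ut cvt.
exists c; split; [exact: cE | by eexists; exact: cB | move=> h E hr gE _].
apply: cF; first exact: hr.
move=> n.
have -> : series (fun j => a n * (g j n)%:C * h ^+ j) =
    (fun N => a n * series (fun j => (g j n)%:C * h ^+ j) N).
  by apply/funext => N; rewrite /series /= mulr_sumr; apply: eq_bigr => j _; rewrite mulrA.
by apply: cvgM; [exact: cvg_cst | exact: gE].
Qed.

Lemma summation_by_parts (a A E : nat -> Cplx R) N :
  (forall n, A n.+1 - A n = a n) ->
  series (fun n => a n * E n) N =
  A N * E N - A 0%N * E 0%N - series (fun n => A n.+1 * (E n.+1 - E n)) N.
Proof.
move=> Aa; apply/eqP; rewrite eq_sym subr_eq eq_sym; apply/eqP.
rewrite /series /= -big_split /= -(telescope_sumr (fun n => A n * E n)) //.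
by apply: eq_bigr => n _; rewrite -Aa; ring.
Qed.

Lemma bounded_cvg0 (A E : nat -> Cplx R) (B : R) : (forall n, cmod (A n) <= B) ->
  E @ \oo --> (0 : Cplx R) -> (fun n => A n * E n) @ \oo --> (0 : Cplx R).
Proof.
move=> AB /ccvg_cmod; rewrite cmod0 => E0.
apply: (@ccvg_le _ _ _ _ _ _ (fun n => B * cmod (E n))).
  by apply: nearW => n; rewrite subr0 cmodM ler_wpM2r ?cmod_ge0.
by rewrite -(mulr0 B); apply: cvgM => //; exact: cvg_cst.
Qed.

(** Summation by parts: a periodic sequence of mean zero is the difference of
    another one, so replacing [g] by its differences costs only the boundary
    term at 0. *)
Lemma summable_periodic_diff r g (B0 : R) : 0 < r ->
  (forall j, (g j) @ \oo --> (0 : R)) -> (forall j, `|g j 0%N| * r ^+ j <= B0) ->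
  summable_periodic r (fun j n => g j n.+1 - g j n) -> summable_periodic r g.
Proof.
move=> r0 g0 gB sg a ma.
have [A mA Aa] := mean_zero_antiderivative ma.
have [BA BA0 AB] := periodic_bounded mA.1.
have [c' [c'E [B' c'B] c'F]] := sg _ (mean_zero_shift mA).
pose c j : Cplx R := - (A 0%N * (g j 0%N)%:C) - c' j.
have parts (E E' : nat -> Cplx R) (v : Cplx R) : (forall n, E' n = E n.+1 - E n) ->
    E @ \oo --> (0 : Cplx R) -> series (fun n => A n.+1 * E' n) @ \oo --> v ->
    series (fun n => a n * E n) @ \oo --> (- (A 0%N * E 0%N) - v : Cplx R).
  move=> E'E E0 cv.
  have -> : series (fun n => a n * E n) =
      (fun N => A N * E N - A 0%N * E 0%N - series (fun n => A n.+1 * E' n) N).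
    apply/funext => N; rewrite (summation_by_parts _ _ Aa); congr (_ - _).
    by apply: eq_bigr => n _; rewrite E'E.
  rewrite -[X in _ --> X + _]sub0r; apply: cvgB; last exact: cv.
  by apply: cvgB; [exact: bounded_cvg0 E0 | exact: cvg_cst].
exists c; split.
- move=> j; apply: (parts (fun n => (g j n)%:C) (fun n => (g j n.+1 - g j n)%:C) (c' j)).
  + by move=> n; rewrite rmorphB.
  + exact: (ccvg_real (g0 j)).
  + exact: c'E.
- exists (BA * B0 + B') => j; rewrite /c.
  apply: (@le_trans _ _ ((cmod (A 0%N) * `|g j 0%N| + cmod (c' j)) * r ^+ j)).
    rewrite ler_wpM2r ?exprn_ge0 ?(ltW r0) //.
    by apply: le_trans (cmodD _ _) _; rewrite !cmodN cmodM cmod_real.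
  rewrite mulrDl lerD // -mulrA ler_pM ?cmod_ge0 //.
  by rewrite mulr_ge0 // exprn_ge0 // ltW.
- move=> h E hr gE E0.
  have E'0 : (fun n => E n.+1 - E n) @ \oo --> (0 : Cplx R).
    rewrite -(subr0 0); apply: cvgB => //.
    by rewrite cvg_shiftS.
  have [|v cv Av] := c'F h (fun n => E n.+1 - E n) hr _ E'0.
    move=> n.
    have -> : series (fun j => (g j n.+1 - g j n)%:C * h ^+ j) =
        (fun N => series (fun j => (g j n.+1)%:C * h ^+ j) N -
                  series (fun j => (g j n)%:C * h ^+ j) N).
      apply/funext => N; rewrite /series /= -sumrB; apply: eq_bigr => j _.
      by rewrite rmorphB mulrBl.
    exact: (ccvgB (gE n.+1) (gE n)).
  exists (- (A 0%N * E 0%N) - v : Cplx R); last exact: (parts E (fun n => E n.+1 - E n) v).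
  have -> : series (fun j => c j * h ^+ j) =
      (fun N => - (A 0%N * series (fun j => (g j 0%N)%:C * h ^+ j) N) -
         series (fun j => c' j * h ^+ j) N).
    apply/funext => N; rewrite /series /= mulr_sumr -sumrN -sumrB.
    by apply: eq_bigr => j _; rewrite /c; ring.
  apply: cvgB; last exact: cv.
  by apply: cvgN; apply: cvgM; [exact: cvg_cst | exact: gE].
Qed.

End PeriodicSums.

(** * Differences of powers and logarithms *)

Section LogPowers.
Context {R : realType}.
Implicit Types (x y : R) (m al j r : nat).

(** The [j]-th Taylor coefficient in [w] of [x ^ (- (al + w))]. *)
Definition logpow al j x : R := x ^- al * ((- ln x) ^+ j / j`!%:R).

(** The [m]-th derivative of [logpow al j]; each differentiation raises the
    exponent [al] by one. *)
Fixpoint dlogpow m al j x : R :=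
  if m is m'.+1 then
    - (al%:R * dlogpow m' al.+1 j x) -
    (if j is j'.+1 then dlogpow m' al.+1 j' x else 0)
  else logpow al j x.

Lemma is_derive_logpow al j x : 0 < x ->
  is_derive x 1 (logpow al j) (dlogpow 1 al j x).
Proof.
move=> x0; have xn0 : x != 0 by rewrite gt_eqF.
have dln := is_derive1_ln x0.
have powfE (f : R -> R) n : (fun y => f y ^+ n) = f ^+ n.
  apply/funext => y; elim: n => [|n ih]; first by rewrite !expr0.
  by rewrite !exprS ih.
have dV : is_derive x 1 (fun y : R => (y ^+ al)^-1)
    (- (x ^+ al) ^- 2 *: ((al%:R * x ^+ al.-1) *: 1)).
  apply: (@is_deriveV _ (fun y : R => y ^+ al)); first by rewrite expf_neq0.
  by rewrite (powfE id); exact: is_deriveX.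
have dX : is_derive x 1 (fun y : R => (- ln y) ^+ j)
    ((j%:R * (- ln x) ^+ j.-1) *: (- x^-1)).
  by rewrite powfE; exact: is_deriveX.
have dZ : is_derive x 1 (fun y : R => (- ln y) ^+ j / j`!%:R)
    ((j`!%:R)^-1 *: ((j%:R * (- ln x) ^+ j.-1) *: (- x^-1))).
  rewrite (_ : (fun _ => _) = (j`!%:R)^-1 \*: (fun y : R => (- ln y) ^+ j)).
    exact: is_deriveZ.
  by apply/funext => y /=; rewrite mulrC.
have -> : logpow al j = (fun y : R => (y ^+ al)^-1) *
    (fun y : R => (- ln y) ^+ j / j`!%:R) by [].
apply: is_derive_eq; rewrite /dlogpow /logpow /=.
have fn0 i : (i`!%:R : R) != 0 by rewrite pnatr_eq0 -lt0n fact_gt0.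
rewrite /GRing.scale /= !mulr1.
case: al {dV} => [|al] /=; case: j {dX dZ} => [|j] /=.
- by rewrite fact0; field; rewrite xn0.
- have j0 : (j.+1%:R : R) != 0 by rewrite pnatr_eq0.
  rewrite factS natrM !exprS; move: (fn0 j) j0.
  move: (j`!%:R : R) (j.+1%:R : R) ((- ln x) ^+ j) => f k l f0 k0.
  by field; rewrite xn0 f0 k0.
- have xal : x ^+ al != 0 by rewrite expf_neq0.
  rewrite fact0 !exprS; move: xal (al.+1%:R : R); move: (x ^+ al) => y y0 k.
  by field; rewrite xn0 y0.
- have xal : x ^+ al != 0 by rewrite expf_neq0.
  have j0 : (j.+1%:R : R) != 0 by rewrite pnatr_eq0.
  rewrite factS natrM !exprS; move: (fn0 j) j0 xal (al.+1%:R : R).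
  move: (j`!%:R : R) (j.+1%:R : R) ((- ln x) ^+ j) (x ^+ al) => f k l y f0 k0 y0 a.
  by field; rewrite xn0 f0 k0 y0.
Qed.

Lemma is_derive_dlogpow m al j x : 0 < x ->
  is_derive x 1 (dlogpow m al j) (dlogpow m.+1 al j x).
Proof.
move=> x0; elim: m al j => [|m ih] al j; first exact: is_derive_logpow.
have d1 := ih al.+1 j.
case: j d1 => [|j] d1.
  rewrite (_ : dlogpow m.+1 al 0 = (- al%:R) \*: dlogpow m al.+1 0).
    apply: is_derive_eq; rewrite [in RHS]/= subr0.
    by rewrite /GRing.scale /= mulNr.
  by apply/funext => y /=; rewrite subr0 /GRing.scale /= mulNr.
have d2 := ih al.+1 j.
rewrite (_ : dlogpow m.+1 al j.+1 =
    (- al%:R) \*: dlogpow m al.+1 j.+1 - dlogpow m al.+1 j).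
  by apply: is_derive_eq; rewrite /GRing.scale /= mulNr.
by apply/funext => y; rewrite /= -mulNr.
Qed.

(** One term of the exponential series of [r * ln x] is at most [x ^ r]. *)
Lemma logpow_bound r al j x : 1 <= x ->
  `|logpow al j x| * r%:R ^+ j <= x ^+ r / x ^+ al.
Proof.
move=> x1; have x0 : 0 < x by rewrite (lt_le_trans ltr01).
have l0 := ln_ge0 x1.
rewrite /logpow normrM normrM normrX normrN (ger0_norm l0) !normfV.
rewrite [`|x ^+ al|]ger0_norm ?exprn_ge0 ?(ltW x0) // normr_nat.
rewrite [leRHS]mulrC -mulrA ler_wpM2l ?invr_ge0 ?exprn_ge0 ?(ltW x0) //.
rewrite mulrAC -exprMn [ln x * _]mulrC; apply: le_trans (expr_fact_le _ _) _.
  by rewrite mulr_ge0.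
by rewrite expRM_natl lnK.
Qed.

Lemma dlogpow_bound r m al : exists2 C, 0 <= C & forall j x, 1 <= x ->
  `|dlogpow m al j x| * r%:R ^+ j <= C * (x ^+ r / x ^+ (al + m)).
Proof.
elim: m al => [|m ih] al.
  by exists 1 => // j x x1; rewrite mul1r addn0 /=; apply: logpow_bound.
have [C C0 CP] := ih al.+1; exists (al%:R * C + r%:R * C).
  by rewrite addr_ge0 // mulr_ge0.
move=> j x x1; rewrite addnS -addSn /= mulrDl -!mulrA.
apply: le_trans (ler_wpM2r _ (ler_normB _ _)) _; first exact: exprn_ge0.
rewrite mulrDl lerD //.
  by rewrite normrN normrM normr_nat -mulrA ler_wpM2l // CP.
case: j => [|j].
  rewrite normr0 mul0r !mulr_ge0 ?invr_ge0 ?exprn_ge0 //;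
  by apply: le_trans x1.
by rewrite exprS mulrCA ler_wpM2l // CP.
Qed.

Definition fwd_diff (f : R -> R) : R -> R := fun x => f (x + 1) - f x.

(** An iterated difference is a value of the corresponding derivative: apply the
    statement for [m] to the differences of the family [f], then the mean value
    theorem once more. *)
Lemma iter_fwd_diff_MVT m (f : nat -> R -> R) :
  (forall i x, 0 < x -> is_derive x 1 (f i) (f i.+1 x)) ->
  forall x, 0 < x -> exists y, [/\ x <= y, y <= x + m%:R &
    iter m fwd_diff (f 0%N) x = f m y].
Proof.
elim: m f => [|m ih] f fd x x0; first by exists x; rewrite addr0.
have x10 y : 0 < y -> 0 < y + 1 by move=> y0; rewrite addr_gt0.
have [|y [xy ym /= yE]] := ih (fun i => fwd_diff (f i)) _ x x0.
  move=> i y y0.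
  have d1 : is_derive y 1 (fun y => f i (y + 1)) (f i.+1 (y + 1)).
    have dg : is_derive y 1 (fun y : R => y + 1) (1 + 0).
      by apply: is_deriveD.
    have := @is_derive1_comp _ (f i) (fun y => y + 1) y _ _ (fd i _ (x10 y y0)) dg.
    by rewrite addr0 mulr1.
  have d2 := fd i y y0.
  exact: is_deriveB.
have y0 : 0 < y by apply: lt_le_trans xy.
have [|z zin||z] := @MVT _ (f m) (f m.+1) y (y + 1); first by rewrite ltrDl.
- by apply: fd; move: zin; rewrite in_itv /= => /andP[/(lt_trans y0)].
- apply: derivable_within_continuous => z; rewrite in_itv /= => /andP[yz _].
  by have [] := fd m z (lt_le_trans y0 yz).
rewrite in_itv /= => /andP[yz zy] fz; exists z; split.
- exact: le_trans xy (ltW yz).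
- rewrite -natr1 addrA; apply: le_trans (ltW zy) _; by rewrite lerD2r.
- by rewrite -iterS iterSr yE /fwd_diff fz addrAC subrr add0r mulr1.
Qed.

Variable q : nat.
Hypothesis q_gt0 : (0 < q)%N.

(** The [i]-th differences of [logpow 2 j] are [O (n ^ (r - 2 - i) * r ^ - j)], so
    after [r] summations by parts the series converges absolutely. The boundary
    terms vanish at infinity by the same bound with 1 in place of [r]. *)
Lemma summable_periodic_logpow r : (0 < r)%N ->
  summable_periodic q (r%:R : R) (fun j n => logpow 2 j n.+1%:R).
Proof.
move=> r0; pose g i j n := iter i fwd_diff (logpow 2 j) n.+1%:R.
have r0' : (0 : R) < r%:R by rewrite ltr0n.
have gMVT i j n : exists y, [/\ n.+1%:R <= y, y <= n.+1%:R + i%:R &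
    g i j n = dlogpow i 2 j y].
  apply: (@iter_fwd_diff_MVT i (fun m => dlogpow m 2 j)) => // m x x0.
  exact: is_derive_dlogpow.
(* Descending induction on the number [r - i] of differences already taken. *)
suff H i : (i <= r)%N -> summable_periodic q (r%:R : R) (g (r - i)%N).
  by have := H r (leqnn r); rewrite subnn.
elim: i => [|i ih] ir.
  rewrite subn0; have [C C0 CP] := dlogpow_bound r r 2.
  apply: (@summable_periodic_abs _ _ q_gt0 _ _ C) => // j n.
  have [y [ny _ ->]] := gMVT r j n.
  have y1 : 1 <= y by apply: le_trans ny; rewrite ler1n.
  have y0 : 0 < y by apply: lt_le_trans y1.
  apply: le_trans (CP _ _ y1) _; rewrite ler_wpM2l //.
  rewrite addnC exprD invfM mulrA divff ?mul1r ?expf_neq0 ?gt_eqF //.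
  rewrite lef_pV2 ?posrE ?exprn_gt0 // lerXn2r // ?nnegrE ?ler0n //; exact: ltW.
have lti : (r - i.+1 < r)%N by rewrite ltn_subrL r0.
have gS j n : g (r - i)%N j n = g (r - i.+1)%N j n.+1 - g (r - i.+1)%N j n.
  by rewrite -(subnSK ir) /g iterS /fwd_diff natr1.
have [C C0 CP] := dlogpow_bound r (r - i.+1)%N 2.
have [C1 C10 C1P] := dlogpow_bound 1 (r - i.+1)%N 2.
apply: (@summable_periodic_diff _ _ q_gt0 _ _ (C * (1 + (r - i.+1)%:R) ^+ r)) => //.
- move=> j; apply/cvgr0Pnorm_le => e e0.
  have := @near_infty_natSinv_lt R (PosNum (divr_gt0 e0 (ltr_wpDl C10 ltr01))).
  apply: filterS => n /= /ltW ne.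
  have [y [ny _ ->]] := gMVT (r - i.+1)%N j n.
  have y1 : 1 <= y by apply: le_trans ny; rewrite ler1n.
  have y0 : 0 < y by apply: lt_le_trans y1.
  have := C1P j y y1; rewrite expr1n mulr1 expr1 => /le_trans; apply.
  rewrite addSn exprS invfM mulVKf ?gt_eqF //.
  rewrite ler_pdivlMr in ne; last by rewrite ltr_wpDl.
  apply: le_trans ne; rewrite mulrC ler_pM ?invr_ge0 ?exprn_ge0 ?(ltW y0) ?lerDl //.
  rewrite lef_pV2 ?posrE ?exprn_gt0 // addSn exprS.
  apply: le_trans ny _; rewrite ler_peMr ?(ltW y0) //.
  exact: exprn_ege1.
- move=> j; have [y [ny yn ->]] := gMVT (r - i.+1)%N j 0%N.
  have y0 : 0 < y by apply: lt_le_trans ny.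
  apply: le_trans (CP _ _ ny) _; rewrite ler_wpM2l //.
  rewrite ler_pdivrMr ?exprn_gt0 //.
  apply: (@le_trans _ _ ((1 + (r - i.+1)%:R) ^+ r)).
    rewrite lerXn2r ?nnegrE ?(ltW y0) ?addr_ge0 //.
  by rewrite ler_peMr ?exprn_ge0 ?addr_ge0 // exprn_ege1.
- have -> : (fun j n => g (r - i.+1)%N j n.+1 - g (r - i.+1)%N j n) = g (r - i)%N.
    by apply/funext => j; apply/funext => n; rewrite gS.
  exact/ih/ltnW.
Qed.

End LogPowers.

(** * Analytic continuation and its uniqueness *)

Section AnalyticContinuation.
Context {R : realType}.
Implicit Types (z w h s : Cplx R).

Lemma nbhs_cmodP z (P : set (Cplx R)) :
  nbhs z P <-> exists2 e : R, 0 < e & forall w, cmod (w - z) < e -> P w.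
Proof.
split.
  move=> /nbhs_ballP[[a b]] /=; rewrite ltcE /= => /andP[/eqP -> a0] bP.
  exists a => // w wz; apply: bP; rewrite /ball /= /ball_ /=.
  by rewrite normrE_cmod ltcR cmodB.
move=> [e e0 eP]; apply/nbhs_ballP; exists e%:C; first by rewrite /= ltcR.
move=> w; rewrite /ball /= /ball_ /= normrE_cmod ltcR cmodB; exact: eP.
Qed.

Lemma ccvg_terms_bounded (u : nat -> Cplx R) (v : Cplx R) : series u @ \oo --> v ->
  exists B, forall n, cmod (u n) <= B.
Proof.
move=> uv.
have cv : (fun n => cmod (series u n)) @ \oo --> cmod v by exact: ccvg_cmod uv.
have [B [Br /(_ (B + 1))]] := cvg_seq_bounded (cvgP _ cv).
rewrite ltrDl ltr01 => /(_ isT) SB; exists (B + 1 + (B + 1)) => n.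
have -> : u n = series u n.+1 - series u n.
  by rewrite /series /= big_nat_recr //= addrAC subrr add0r.
apply: le_trans (cmodD _ _) _; rewrite cmodN.
by apply: lerD; apply: le_trans (ler_norm _) _; apply: (SB _ I).
Qed.

Lemma analytic_atB (f g : Cplx R -> Cplx R) z :
  analytic_at f z -> analytic_at g z -> analytic_at (fun w => f w - g w) z.
Proof.
move=> [a fa] [b gb]; exists (fun n => a n - b n).
apply: filterS2 fa gb => w fw gw.
have -> : series (fun n => (a n - b n) * (w - z) ^+ n) =
    (fun N => series (fun n => a n * (w - z) ^+ n) N -
              series (fun n => b n * (w - z) ^+ n) N).
  by apply/funext => N; rewrite /series /= -sumrB; apply: eq_bigr => i _; rewrite mulrBl.
by apply: ccvgB; [exact: fw | exact: gw].
Qed.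

(** The first non-zero Taylor coefficient, if there is one, dominates the sum of the
    following terms close to the centre. *)
Lemma analytic_isolated_zero (D : Cplx R -> Cplx R) z : analytic_at D z ->
  (\forall w \near z, D w = 0) \/ (\forall w \near z, w != z -> D w != 0).
Proof.
move=> [a Da].
have [a0|/existsNP[i /eqP ai]] := pselect (forall i, a i = 0).
  left; apply: filterS Da => w Dw; apply: (ccvg_unique Dw).
  have -> : series (fun n => a n * (w - z) ^+ n) = (fun=> 0 : Cplx R).
    by apply/funext => N; rewrite /series /= big1 // => i _; rewrite a0 mul0r.
  exact: cvg_cst.
right.
have [m am a_lt] : exists2 m, a m != 0 & forall i, (i < m)%N -> a i = 0.
  have ex : exists i, a i != 0 by exists i.
  exists (ex_minn ex); case: ex_minnP => // m _ mP j; apply: contraTeq => /mP.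
  by rewrite -leqNgt.
have /nbhs_cmodP[e e0 eD] := Da.
(* Convergence at the point [z + h0] bounds the coefficients geometrically. *)
pose h0 : Cplx R := (e / 2)%:C.
have r0 : 0 < cmod h0 by rewrite cmod_real gtr0_norm ?divr_gt0.
have [B aB] : exists B, forall n, cmod (a n) * cmod h0 ^+ n <= B.
  have [|B BP] := @ccvg_terms_bounded (fun n => a n * h0 ^+ n) (D (z + h0)).
    have := eD (z + h0); rewrite [z + h0]addrC addrK; apply.
    by rewrite cmod_real gtr0_norm ?divr_gt0 // ltr_pdivrMr // ltr_pMr // ltr1n.
  by exists B => n; rewrite -cmodX -cmodM.
have am0 : 0 < cmod (a m) by rewrite lt_def cmod_eq0 am cmod_ge0.
have B0 : 0 < B by apply: lt_le_trans (aB m); rewrite mulr_gt0 ?exprn_gt0.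
pose r := cmod h0.
pose d := Num.min e (Num.min (r / 2) (r * (cmod (a m) * r ^+ m / (2 * B)))).
have d0 : 0 < d.
  by rewrite /d !lt_min e0 (divr_gt0 r0) // mulr_gt0 // divr_gt0 // mulr_gt0 // exprn_gt0.
apply/nbhs_cmodP; exists d => // w; rewrite !lt_min => /and3P[we wr wB] wz.
apply/eqP => Dw0.
have := eD w we; rewrite Dw0; set h := w - z => Dh.
have h_gt0 : 0 < cmod h by rewrite lt_def cmod_eq0 subr_eq0 wz cmod_ge0.
have hr : cmod h < r by apply: lt_trans wr _; rewrite ltr_pdivrMr // ltr_pMr ?ltr1n.
have [v hv /(_ m.+1)] := pseries_dominated r0 hr aB.
have <- := ccvg_unique Dh hv; rewrite sub0r cmodN -/r.
have -> : series (fun i => a i * h ^+ i) m.+1 = a m * h ^+ m.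
  rewrite /series /= big_nat_recr //= big1_seq ?add0r // => j /andP[_].
  by rewrite mem_index_iota => /andP[_ /a_lt ->]; rewrite mul0r.
pose x := cmod h / r; rewrite -/x.
have x0 : 0 < x by rewrite /x divr_gt0.
have x2 : x < 2^-1 by rewrite /x ltr_pdivrMr // mulrC.
have xB : x < cmod (a m) * r ^+ m / (2 * B) by rewrite /x ltr_pdivrMr // mulrC.
apply/negP; rewrite -ltNge ltr_pdivrMr ?subr_gt0; last first.
  by apply: lt_trans x2 _; rewrite invf_lt1 ?ltr1n.
have -> : cmod (a m * h ^+ m) = cmod (a m) * r ^+ m * x ^+ m.
  by rewrite cmodM cmodX /x expr_div_n -mulrA [r ^+ m * _]mulrC divfK // expf_neq0 // gt_eqF.
rewrite ltr_pdivlMr ?mulr_gt0 // in xB.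
rewrite exprS [ltLHS]mulrA [ltRHS]mulrAC ltr_pM2r ?exprn_gt0 //.
set y := cmod (a m) * r ^+ m in xB *.
have y0 : 0 < y by rewrite mulr_gt0 ?exprn_gt0.
suff : y / 2 <= y * (1 - x) by lra.
by rewrite ler_pM2l //; lra.
Qed.

(** The interior of the zero set of [D] is open, and relatively closed in [U]
    because the zeros of [D] are isolated elsewhere. *)
Lemma identity_theorem (U : set (Cplx R)) (D : Cplx R -> Cplx R) z0 :
  connected U -> (forall z, U z -> analytic_at D z) ->
  U z0 -> (\forall w \near z0, D w = 0) -> forall z, U z -> D z = 0.
Proof.
move=> cU aD Uz0 Dz0; pose V := interior [set z | D z = 0].
have VU : U `&` V = U.
  apply: cU.
  - by exists z0.
  - by exists V => //; exact: open_interior.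
  - exists (closure V); first exact: closed_closure.
    apply/seteqP; split=> z [Uz Vz]; split; [exact: Uz | exact: subset_closure Vz | exact: Uz |].
    have [//|Dz] := analytic_isolated_zero (aD z Uz).
    have [y [Vy Dy]] := Vz _ Dz.
    have [yz|yz] := eqVneq y z; first by rewrite -yz.
    case/negP: (Dy yz); apply/eqP; exact: (nbhs_singleton Vy).
move=> z; rewrite -VU => -[_ Vz]; exact: (nbhs_singleton Vz).
Qed.

(** The plane is the union of the segments from 0. *)
Lemma connectedT_C : connected [set: Cplx R].
Proof.
pose f z (t : R) : Cplx R := t%:C * z.
have -> : [set: Cplx R] = \bigcup_(z in [set: Cplx R]) (f z @` `[0, 1]%classic).
  apply/seteqP; split=> // z _; exists z => //; exists 1; last by rewrite /f mul1r.
  by rewrite /= in_itv /= ler01 lexx.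
apply: bigcup_connected.
  exists 0 => z _; exists 0; last by rewrite /f mul0r.
  by rewrite /= in_itv /= ler01 lexx.
move=> z _; apply: connected_continuous_connected; first exact: segment_connected.
apply: continuous_subspaceT => t.
apply: ccvg_ReIm; rewrite /f.
  rewrite Re_realM; under eq_fun do rewrite Re_realM.
  by apply: cvgM; [exact: cvg_id | exact: cvg_cst].
rewrite Im_realM; under eq_fun do rewrite Im_realM.
by apply: cvgM; [exact: cvg_id | exact: cvg_cst].
Qed.

Lemma entire_analytic (c : nat -> Cplx R) (F : Cplx R -> Cplx R) z0 z :
  entire_coef c -> (forall w, series (fun i => c i * w ^+ i) @ \oo --> F w) ->
  analytic_at (fun s => F (s - z0)) z.
Proof.
move=> ec cF; have [b [_ _ bF]] := entire_recenter (z - z0) ec cF.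
exists b; apply: filterE => w.
have -> : w - z0 = z - z0 + (w - z) by ring.
exact: bF.
Qed.

Lemma npowN_cvg0 s : 0 < complex.Re s ->
  (fun n => npowN n.+1 s) @ \oo --> (0 : Cplx R).
Proof.
move=> s0; apply/ccvgP; apply/cvgr0Pnorm_le => e e0.
have := @nbhs_infty_gtr R (expR (- ln e / complex.Re s)).
apply: filterS => n; move=> lt_n.
have ne : - ln e / complex.Re s < ln n.+1%:R.
  rewrite -ltr_expR lnK ?posrE ?ltr0n //; apply: lt_trans lt_n _.
  by rewrite ltr_nat.
rewrite subr0 cmod_npowN ger0_norm ?expR_ge0 // -[leRHS]lnK ?posrE // ler_expR.
move: ne; rewrite ltr_pdivrMr // => ne; rewrite mulNr lerNl mulrC; exact: ltW.
Qed.

Lemma logpow_series n h :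
  series (fun j => (logpow 2 j n.+1%:R)%:C * h ^+ j) @ \oo --> npowN n.+1 ((2 : R)%:C + h).
Proof.
have n0 : (0 : R) < n.+1%:R by rewrite ltr0n.
rewrite npowND npowN_real.
have -> : expR (- 2 * ln n.+1%:R) = n.+1%:R ^- 2 :> R.
  by rewrite mulNr expRN expRM_natl lnK.
have -> : series (fun j => (logpow 2 j n.+1%:R)%:C * h ^+ j) = (fun N => (n.+1%:R ^- 2)%:C *
    series (fun j => (j`!%:R)^-1 * (- h * (ln n.+1%:R)%:C) ^+ j) N).
  apply/funext => N; rewrite /series /= mulr_sumr; apply: eq_bigr => j _.
  rewrite /logpow rmorphM -mulrA; congr (_ * _).
  rewrite rmorphM rmorphXn rmorphN fmorphV rmorph_nat /= mulNr -mulrN exprMn; ring.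
by apply: ccvgMr; exact: cexp_series.
Qed.

(** [summable_periodic_logpow] gives a power series centred at 2 for every radius.
    Its coefficients are the same sums whatever the radius, so it is one entire
    power series, and any [s] is within reach of a large enough radius. *)
Lemma periodic_dirichlet_entire q (a : nat -> Cplx R) : (0 < q)%N ->
  periodic_mean_zero q a ->
  exists c F, [/\ entire_coef c,
    forall w, series (fun j => c j * w ^+ j) @ \oo --> (F w : Cplx R)
  & forall s, 0 < complex.Re s ->
    series (fun n => a n * npowN n.+1 s) @ \oo --> (F (s - (2 : R)%:C) : Cplx R)].
Proof.
move=> q0 ma.
have key r : (0 < r)%N -> exists c : nat -> Cplx R,
    [/\ forall j, series (fun n => a n * (logpow 2 j n.+1%:R)%:C) @ \oo --> c j,
        exists B, forall j, cmod (c j) * r%:R ^+ j <= B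
      & forall h, cmod h < r%:R -> 0 < complex.Re ((2 : R)%:C + h) ->
        exists2 v : Cplx R, series (fun j => c j * h ^+ j) @ \oo --> v &
          series (fun n => a n * npowN n.+1 ((2 : R)%:C + h)) @ \oo --> v].
  move=> r0; have [c [cE cB cF]] := @summable_periodic_logpow R q q0 r r0 a ma.
  exists c; split; [exact: cE | exact: cB | move=> h hr h0].
  apply: cF; [exact: hr | move=> n; exact: logpow_series | exact: npowN_cvg0].
have [c [cE _ _]] := key 1%N isT.
have same c' : (forall j, series (fun n => a n * (logpow 2 j n.+1%:R)%:C) @ \oo --> (c' j : Cplx R)) -> c' = c.
  by move=> c'E; apply/funext => j; apply: ccvg_unique (c'E j) (cE j).
have large (x : R) : exists2 r, (0 < r)%N & x < r%:R.
  have [N _ /(_ N.+1 (leqnSn N)) xN] := nbhs_infty_gtr x.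
  by exists N.+1.
have ec : entire_coef c.
  move=> x x0; have [r r0 xr] := large x.
  have [c' [/same -> [B cB] _]] := key r r0.
  exists B => i; apply: le_trans (cB i); rewrite ler_wpM2l ?cmod_ge0 //.
  by rewrite lerXn2r ?nnegrE ?ler0n ?(ltW xr) ?(ltW x0).
have /choice[F FE] := entire_cvg ec.
exists c, F; split; [exact: ec | exact: FE | move=> s s0].
have [r r0 hr] := large (cmod (s - (2 : R)%:C)).
have [c' [/same -> _ cF]] := key r r0.
have sE : (2 : R)%:C + (s - (2 : R)%:C) = s by rewrite addrC subrK.
have [|v cv sv] := cF _ hr; first by rewrite sE.
by rewrite (ccvg_unique (FE _) cv); move: sv; rewrite sE.
Qed.

(** The existence of an entire continuation makes the value of any other
    continuation unambiguous, whatever connected domain it is defined on. *)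
Lemma dirichletL_cvg q (chi : nat -> Cplx R) s : (0 < q)%N ->
  periodic_mean_zero q (fun n => chi n.+1) -> 0 < complex.Re s ->
  series (fun n => chi n.+1 * npowN n.+1 s) @ \oo --> dirichletL chi s.
Proof.
move=> q0 mchi s0.
have [c [F [ec cF sF]]] := periodic_dirichlet_entire q0 mchi.
pose L s := F (s - (2 : R)%:C).
have aL z : analytic_at L z by apply: (entire_analytic _ _ ec cF).
have contL : dirichletL_continuation chi setT L.
  split; [exact: openT | exact: connectedT_C | by [] | move=> z _; exact: aL |].
  by move=> z z1; apply: sF; apply: lt_trans z1.
suff -> : dirichletL chi s = L s by exact: sF.
have := @xgetPex _ (0 : Cplx R) [set v | exists U f,
    [/\ dirichletL_continuation chi U f, U s & f s = v]].
rewrite -/(dirichletL chi s) /=.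
case; first by exists (L s), setT, L.
move=> U [f [[oU cU hU af sf] Us <-]].
apply/eqP; rewrite -subr_eq0; apply/eqP.
(* The two continuations agree near 3, where both are the Dirichlet series. *)
have three : 1 < complex.Re ((3 : R)%:C : Cplx R) by rewrite /= ltr1n.
apply: (@identity_theorem U (fun w => f w - L w) (3 : R)%:C cU _ _ _ s Us).
- by move=> z Uz; apply: analytic_atB; [exact: af | exact: aL].
- exact: hU.
apply/nbhs_cmodP; exists 1 => // w w3.
have w1 : 1 < complex.Re w.
  have := le_lt_trans (Re_le_cmod _) w3; rewrite ReD ReN /= ltr_norml => /andP[+ _].
  by rewrite ltrBrDr; lra.
apply/eqP; rewrite subr_eq0; apply/eqP.
apply: ccvg_unique (sf w w1) _.
by apply: sF; apply: lt_trans w1.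
Qed.

End AnalyticContinuation.

(** * Dirichlet characters modulo a prime *)

Section Characters.
Context {R : realType}.
Variable q : nat.
Hypothesis q_prime : prime q.
Local Notation C := (Cplx R).
Local Notation n := q.-1.

Let q_gt0 : (0 < q)%N. Proof. exact: prime_gt0. Qed.
Let n_gt0 : (0 < n)%N. Proof. by case: q (prime_gt1 q_prime) => [|[]]. Qed.

Lemma Fp_natr_eq (a b : nat) : (a%:R == b%:R :> 'F_q) = (a == b %[mod q]).
Proof. by rewrite -val_eqE /= !val_Fp_nat. Qed.

Lemma Fp_natr_eq0 (a : nat) : (a%:R == 0 :> 'F_q) = ~~ coprime a q.
Proof.
rewrite (Fp_natr_eq a 0) mod0n -/(dvdn q a) coprime_sym prime_coprime //.
by rewrite negbK.
Qed.

Lemma Fp_fermat (x : 'F_q) : x != 0 -> x ^+ n = 1.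
Proof.
move=> x0; apply: (mulfI x0); rewrite mulr1 -exprS prednK //.
by have := expf_card x; rewrite card_Fp.
Qed.

(** Among the roots of ['X^n - 1] in a field, if there are [n] of them, one is a
    primitive root; for [n = q - 1] all non-zero elements are roots. *)
Lemma primitive_root_Fp : exists g : 'F_q, n.-primitive_root g.
Proof.
pose rs := [seq x <- enum 'F_q | x != 0].
have /hasP[g _ gP] : has n.-primitive_root rs; last by exists g.
apply: has_prim_root => //.
- apply/allP => x; rewrite mem_filter => /andP[x0 _].
  by rewrite unity_rootE Fp_fermat.
- by rewrite filter_uniq ?enum_uniq.
- rewrite size_filter -(leq_add2l (count (predC (fun x : 'F_q => x != 0)) (enum 'F_q))).
  rewrite addnC [leqRHS]addnC count_predC -cardE card_Fp //.
  rewrite (eq_count (a2 := pred1 0)) ?count_uniq_mem ?enum_uniq ?mem_enum //=.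
    by rewrite addn1 prednK.
  by move=> x /=; rewrite negbK.
Qed.

(** The same in an algebraically closed field, where ['X^m - 1] is separable. *)
Lemma primitive_root_C m : (0 < m)%N -> exists z : C, m.-primitive_root z.
Proof.
move=> m0; pose p : {poly R[i]} := 'X^m - 1.
have [rs rsE] := closed_field_poly_normal p.
have szp : size p = m.+1 by rewrite size_XnsubC.
have lp : lead_coef p = 1 by rewrite lead_coefXnsubC.
rewrite lp scale1r in rsE.
have /hasP[z _ zP] : has m.-primitive_root rs; last by exists z.
apply: has_prim_root => //.
- apply/allP => z zrs; rewrite unity_rootE -subr_eq0.
  have : root p z by rewrite rsE root_prod_XsubC.
  by rewrite /root /p hornerD hornerN hornerXn hornerC.
- rewrite -separable_prod_XsubC -rsE; apply: separable_Xn_sub_1.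
  by rewrite pnatr_eq0 -lt0n.
- by rewrite -ltnS -szp rsE size_prod_XsubC.
Qed.

Variables (g : 'F_q) (z : C).
Hypotheses (gP : n.-primitive_root g) (zP : n.-primitive_root z).

(** Discrete logarithm to the base [g]; 0 at 0. *)
Definition dlog (x : 'F_q) : nat := oapp val 0%N [pick i : 'I_n | x == g ^+ i].

Lemma dlogK (x : 'F_q) : x != 0 -> g ^+ dlog x = x.
Proof.
move=> /Fp_fermat /(prim_rootP gP)[i xi]; rewrite /dlog.
by case: pickP => [j /eqP -> //|/(_ i)]; rewrite xi eqxx.
Qed.

Let g0 : g != 0.
Proof.
by apply/eqP => g0; move: (prim_expr_order gP); rewrite g0 expr0n gtn_eqF //;
  move/eqP; rewrite eq_sym oner_eq0.
Qed.

Lemma dlogM (x y : 'F_q) : x != 0 -> y != 0 ->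
  dlog (x * y) = dlog x + dlog y %[mod n].
Proof.
move=> x0 y0; apply/eqP; rewrite -(eq_prim_root_expr gP) exprD.
by rewrite !dlogK ?mulf_neq0.
Qed.

Lemma dlog_eq (x y : 'F_q) : x != 0 -> y != 0 ->
  (dlog x == dlog y %[mod n]) = (x == y).
Proof. by move=> x0 y0; rewrite -(eq_prim_root_expr gP) !dlogK. Qed.

(** The [j]-th power of the character that sends the primitive root [g] to
    [z]. *)
Definition power_char (j m : nat) : C :=
  if (m%:R == 0 :> 'F_q) then 0 else z ^+ (j * dlog m%:R).

Let z_mod i j : i = j %[mod n] -> z ^+ i = z ^+ j.
Proof. by move=> ij; rewrite -(prim_expr_mod zP i) ij prim_expr_mod. Qed.

Let z0 : z != 0.
Proof.
by apply/eqP => z0; move: (prim_expr_order zP); rewrite z0 expr0n gtn_eqF //;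
  move/eqP; rewrite eq_sym oner_eq0.
Qed.

Lemma power_charP j : dirichlet_char R q (power_char j).
Proof.
split=> [m|a b|m]; rewrite /power_char.
- have -> : ((m + q)%:R : 'F_q) = m%:R by apply/eqP; rewrite Fp_natr_eq modnDr.
  by [].
- rewrite natrM mulf_eq0; case: eqP => [_|/eqP a0]; first by rewrite mul0r.
  case: eqP => [_|/eqP b0] /=; first by rewrite mulr0.
  rewrite -exprD -mulnDr; apply: z_mod.
  by rewrite -modnMmr dlogM // modnMmr.
- rewrite Fp_natr_eq0; case: coprime => /=; last by rewrite eqxx.
  by rewrite expf_neq0.
Qed.

Let gnat : exists m : nat, (m%:R : 'F_q) = g.
Proof. by exists (val g); rewrite natr_Zp. Qed.

Lemma power_char_inj : injective (fun j : 'I_n => power_char j).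
Proof.
move=> i j eqij; have [m mg] := gnat.
have := congr1 (@^~ m) eqij; rewrite /power_char mg (negbTE g0).
have dg : dlog g = 1 %[mod n].
  by apply/eqP; rewrite -(eq_prim_root_expr gP) dlogK.
rewrite (z_mod (i := i * _) (j := i)); last by rewrite -modnMmr dg modnMmr muln1.
rewrite (z_mod (i := j * _) (j := j)); last by rewrite -modnMmr dg modnMmr muln1.
move/eqP; rewrite (eq_prim_root_expr zP) !modn_small // => /eqP.
exact: val_inj.
Qed.

(** A character is determined by its value at [g], which is a root of unity of
    order dividing [q - 1]. *)
Lemma dirichlet_charE chi : dirichlet_char R q chi ->
  exists j : 'I_n, chi = power_char j.
Proof.
move=> [chiq chiM chi0]; have [m mg] := gnat.
have chi_mod a b : a = b %[mod q] -> chi a = chi b.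
  by move=> ab; rewrite (periodic_modn a chiq) ab -periodic_modn.
have chi1 : chi 1%N = 1.
  have c1 : chi 1%N != 0 by rewrite chi0 coprime1n.
  by apply: (mulfI c1); rewrite -chiM mulr1.
have chiX a k : chi (a ^ k)%N = chi a ^+ k.
  by elim: k => [|k ih]; rewrite ?expn0 ?chi1 // expnS exprS chiM ih.
have [j jP] : exists j : 'I_n, chi m = z ^+ j.
  have [|j ->] := prim_rootP zP (x := chi m); last by exists j.
  rewrite -chiX -chi1; apply: chi_mod; apply/eqP.
  by rewrite -Fp_natr_eq natrX mg (prim_expr_order gP).
exists j; apply/funext => a; rewrite /power_char.
case: eqP => [/eqP|/eqP a0].
  by rewrite Fp_natr_eq0 -chi0 negbK => /eqP.
have -> : chi a = chi (m ^ dlog a%:R)%N.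
  by apply: chi_mod; apply/eqP; rewrite -Fp_natr_eq natrX mg dlogK.
by rewrite chiX jP exprM.
Qed.

Lemma principal_charE : principal_char R q = power_char 0.
Proof.
apply/funext => m; rewrite /principal_char /power_char Fp_natr_eq0 mul0n expr0.
by case: coprime.
Qed.

Let z_conj : z * z^* = 1.
Proof.
have : cmod z ^+ n = 1 by rewrite -cmodX (prim_expr_order zP) cmod1.
move/eqP; rewrite pexpr_eq1 ?cmod_ge0 -?lt0n // => /eqP z1.
by rewrite -sqr_normc normrE_cmod z1 expr1n.
Qed.

(** The terms form a geometric progression whose ratio is a root of unity, equal
    to 1 only when [a] and [b] have the same discrete logarithm. *)
Lemma power_char_orthogonality (a b : nat) : coprime a q -> coprime b q ->
  \sum_(j < n) power_char j a * (power_char j b)^* =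
  if a == b %[mod q] then n%:R else 0.
Proof.
move=> ca cb; rewrite -Fp_natr_eq.
have a0 : (a%:R : 'F_q) != 0 by rewrite Fp_natr_eq0 negbK.
have b0 : (b%:R : 'F_q) != 0 by rewrite Fp_natr_eq0 negbK.
pose w : C := z ^+ dlog a%:R * (z^* ) ^+ dlog b%:R.
have wE (j : 'I_n) : power_char j a * (power_char j b)^* = w ^+ j.
  rewrite /power_char (negbTE a0) (negbTE b0) rmorphXn /w exprMn -!exprM.
  by rewrite ![(j * _)%N]mulnC.
rewrite (eq_bigr _ (fun j _ => wE j)).
have zX k : z ^+ k * (z^* ) ^+ k = 1 by rewrite -exprMn z_conj expr1n.
have w1 : (w == 1) = (a%:R == b%:R :> 'F_q).
  rewrite -dlog_eq // -(eq_prim_root_expr zP) /w -[X in w == X](zX (dlog b%:R)).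
  have zb : (z^*) ^+ dlog b%:R != 0 by rewrite expf_neq0 // conjc_eq0.
  by rewrite (inj_eq (mulIf zb)).
have wn : w ^+ n = 1.
  rewrite /w exprMn -!exprM ![(dlog _ * _)%N]mulnC !exprM.
  rewrite (prim_expr_order zP) expr1n mul1r.
  have <- : (z ^+ n)^* = (z^*) ^+ n by rewrite rmorphXn.
  by rewrite (prim_expr_order zP) rmorph1 expr1n.
rewrite -w1; case: eqP => [->|/eqP wn1].
  by under eq_bigr do rewrite expr1n; rewrite sumr_const card_ord.
apply: (mulfI (x := w - 1)); first by rewrite subr_eq0.
by rewrite -subrX1 wn subrr mulr0.
Qed.

(** Multiplication by [g] permutes the residues and multiplies the sum by the value
    at [g], which is not 1. *)
Lemma power_char_mean_zero (j : 'I_n) : j != 0%N :> nat ->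
  periodic_mean_zero q (fun m => power_char j m.+1).
Proof.
move=> j0; have [per mul _] := power_charP j.
have [m mg] := gnat.
apply: mean_zero_shift => //; split=> [a|]; first exact: per.
pose X (x : 'F_q) : C := if x == 0 then 0 else z ^+ (j * dlog x).
have -> : \sum_(0 <= i < q) power_char j i = \sum_(x : 'F_q) X x.
  rewrite big_mkord (reindex (fun i : 'I_q => (i%:R : 'F_q))) //.
  exists (fun x : 'F_q => cast_ord (Fp_cast q_prime) x) => i _.
    by apply: val_inj; rewrite /= val_Fp_nat // modn_small.
  by rewrite /= natr_Zp.
have Xg x : X (g * x) = X g * X x.
  rewrite -mg -[x]natr_Zp -natrM; exact: (mul m x).
apply: (mulfI (x := X g - 1)).
  rewrite subr_eq0 /X (negbTE g0) mulnC exprM.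
  have -> : z ^+ dlog g = z.
    rewrite -[RHS]expr1; apply: z_mod; apply/eqP.
    by rewrite -(eq_prim_root_expr gP) dlogK.
  by rewrite -(prim_order_dvd zP) gtnNdvd // lt0n.
rewrite mulr0 mulrBl mul1r mulr_sumr; apply/eqP; rewrite subr_eq0; apply/eqP.
rewrite [RHS](reindex (fun x => g * x)) /=; last first.
  by exists (fun x => g^-1 * x) => x _; rewrite ?mulKf ?mulVKf.
by apply: eq_bigr => x _; rewrite Xg.
Qed.

Lemma nonprincipal_sumE (f : (nat -> C) -> R) :
  \sum_(chi \in (dirichlet_char R q `\ principal_char R q)%classic) f chi =
  \sum_(j < n | j != 0%N :> nat) f (power_char j).
Proof.
pose r := [seq power_char (val j) | j <- [seq j : 'I_n <- enum 'I_n | j != 0%N :> nat]].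
have ur : uniq r.
  rewrite map_inj_uniq; first by rewrite filter_uniq ?enum_uniq.
  exact: power_char_inj.
have -> : (dirichlet_char R q `\ principal_char R q)%classic = [set` r].
  apply/seteqP; split=> chi /=.
    move=> [/dirichlet_charE[j ->] jp]; apply/mapP; exists j => //.
    rewrite mem_filter mem_enum andbT; apply: contra_notN jp => /eqP j0.
    by rewrite principal_charE j0.
  move=> /mapP[j]; rewrite mem_filter => /andP[j0 _] ->; split.
    exact: power_charP.
  rewrite principal_charE => jp; case/negP: j0.
  by rewrite -[0%N]/(val (Ordinal n_gt0)) (power_char_inj (x2 := Ordinal n_gt0) jp).
by rewrite -fsbig_seq // big_map big_filter big_enum_cond.
Qed.

End Characters.

(** * Pairwise coprime tuples *)

Section SumInjection.
Context {R : realType}.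

Lemma ler_sum_inj (I J : finType) (P : pred I) (Q : pred J) (phi : I -> J)
    (F : I -> R) (G : J -> R) :
  {in P &, injective phi} -> (forall i, P i -> Q (phi i)) ->
  (forall i, P i -> F i <= G (phi i)) -> (forall j, Q j -> 0 <= G j) ->
  \sum_(i | P i) F i <= \sum_(j | Q j) G j.
Proof.
move=> injphi PQ FG G0.
apply: (@le_trans _ _ (\sum_(i | P i) G (phi i))); first exact: ler_sum.
pose S := [set phi x | x in P]%SET.
have SQ j : j \in S -> Q j by move=> /imsetP[i iP ->]; exact: PQ.
have -> : \sum_(i | P i) G (phi i) = \sum_(j in S) G j by rewrite big_imset.
rewrite [leRHS](bigID (fun j => j \in S)) /=.
rewrite [X in _ <= X + _](eq_bigl (fun j => j \in S)); last first.
  by move=> j; rewrite andb_idl // => /SQ.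
by rewrite lerDl sumr_ge0 // => j /andP[/G0].
Qed.

End SumInjection.

Section CoprimeTuples.
Context {R : realType}.

Definition pairwise_coprime (J : finType) y (h : {ffun J -> 'I_y}) :=
  [forall a, forall b, (a != b) ==> coprime (h a).+1 (h b).+1].

(** The index is shifted: [i] stands for the integer [i + 1], here and in all the
    sums over ordinals below. *)
Definition coprime_weight (M i : nat) : R := if coprime i.+1 M then i.+1%:R^-1 else 0.

Lemma coprime_weight_ge0 M i : 0 <= coprime_weight M i.
Proof. by rewrite /coprime_weight; case: ifP => // _; rewrite invr_ge0. Qed.

(** Divide the multiples of [d] by [d]. *)
Lemma sum_coprime_weight_multiples M y d : (0 < d)%N ->
  \sum_(i < y | (d %| i.+1)%N) coprime_weight M i <=
  (\sum_(i < y) coprime_weight M i) / d%:R.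
Proof.
move=> d0; rewrite mulr_suml.
have lt_y (i : 'I_y) : ((i.+1 %/ d).-1 < y)%N.
  by have := leq_div i.+1 d; have := ltn_ord i; move: (i.+1 %/ d)%N => t; lia.
pose phi (i : 'I_y) := Ordinal (lt_y i).
have phiS (i : 'I_y) : (d %| i.+1)%N -> ((phi i).+1 * d)%N = i.+1.
  move=> di /=; rewrite prednK ?divnK // divn_gt0 //; exact: dvdn_leq.
apply: (@ler_sum_inj _ _ _ _ _ phi) => //.
- move=> i j di dj eqij; apply: val_inj; apply: succn_inj => /=.
  by rewrite -(phiS i) // -(phiS j) // eqij.
- move=> i di; rewrite /coprime_weight -{1 2}(phiS i di) coprimeMl.
  case: ifP => [/andP[-> _]|_]; first by rewrite natrM invfM.
  by case: ifP => _; rewrite ?mul0r // mulr_ge0 ?invr_ge0.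
- by move=> i _; rewrite mulr_ge0 ?coprime_weight_ge0 ?invr_ge0.
Qed.

(** Comparison with the telescoping series [1 / (d - 1) - 1 / d]. *)
Lemma sum_inv_sqr_le P y : (0 < P)%N ->
  \sum_(P.+1 <= d < y.+1) (d%:R ^+ 2)^-1 <= P%:R^-1 :> R.
Proof.
move=> P0; have [yP|Py] := leqP y P; first by rewrite big_geq ?invr_ge0.
suff : \sum_(P.+1 <= d < y.+1) (d%:R ^+ 2)^-1 <= P%:R^-1 - y%:R^-1 :> R.
  by move/le_trans; apply; rewrite lerBlDr lerDl invr_ge0.
rewrite -(subnK (ltnW Py)); elim: (y - P)%N => [|m ih].
  by rewrite add0n big_geq // subrr.
rewrite addSn big_nat_recr /=; last by rewrite !ltnS leq_addl.
apply: le_trans (lerD ih (lexx _)) _; set x := (m + P)%N.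
have x0 : (0 < x)%N by rewrite /x addn_gt0 P0 orbT.
have x1 : (x%:R : R) != 0 by rewrite pnatr_eq0 -lt0n.
have x2 : (x.+1%:R : R) != 0 by rewrite pnatr_eq0.
rewrite -subr_ge0.
have -> : P%:R^-1 - x.+1%:R^-1 - (P%:R^-1 - x%:R^-1 + (x.+1%:R ^+ 2)^-1) =
   (x%:R * x.+1%:R ^+ 2)^-1 :> R.
  have P1 : (P%:R : R) != 0 by rewrite pnatr_eq0 -lt0n.
  by move: x1 x2; rewrite -[x.+1%:R]natr1; move: (x%:R : R) => u u0 u1; field; rewrite P1 u0 u1.
by rewrite invr_ge0 mulr_ge0 // exprn_ge0.
Qed.

(** A tuple of integers coprime to [P`!] that is not pairwise coprime has two
    entries divisible by the same integer [d > P]; those tuples carry at most the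
    fraction [#|J| ^ 2 * \sum_(d > P) d ^ -2] of the total weight. *)
Lemma sum_pairwise_coprime (J : finType) (y P : nat) : (0 < P)%N ->
  (\sum_(i < y) coprime_weight P`! i) ^+ #|J| * (1 - (#|J| ^ 2)%:R / P%:R) <=
  \sum_(h : {ffun J -> 'I_y} | pairwise_coprime h) (\prod_j (h j).+1)%:R^-1.
Proof.
move=> P0; pose s := coprime_weight P`!; pose T := \sum_(i < y) s i.
have s0 i : 0 <= s i := coprime_weight_ge0 _ _.
have T0 : 0 <= T by apply: sumr_ge0.
have prods0 (h : {ffun J -> 'I_y}) : 0 <= \prod_j s (h j) by apply: prodr_ge0.
pose bad a b d : R := \sum_(h : {ffun J -> 'I_y} |
  (d %| (h a).+1)%N && (d %| (h b).+1)%N) \prod_j s (h j).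
have total : T ^+ #|J| = \sum_(h : {ffun J -> 'I_y}) \prod_j s (h j).
  by rewrite -(bigA_distr_bigA (fun (j : J) (i : 'I_y) => s i)) prodr_const.
(* The sum over tuples factors; two of the factors are restricted to multiples
   of [d]. *)
have bad_le a b d : a != b -> (0 < d)%N -> bad a b d <= T ^+ #|J| * (d%:R ^+ 2)^-1.
  move=> ab d0.
  pose t j (i : 'I_y) := if (j == a) || (j == b) then
    (if (d %| i.+1)%N then s i else 0) else s i.
  have -> : bad a b d = \prod_j \sum_(i < y) t j i.
    rewrite bigA_distr_bigA /bad big_mkcond /=; apply: eq_bigr => h _.
    have [/andP[da db]|] := ifP.
      by apply: eq_bigr => j _; rewrite /t; case: eqP => [->|_] /=;
        rewrite ?da //; case: eqP => [->|_]; rewrite ?db.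
    move=> /negbT; rewrite negb_and => /orP[dn|dn].
      by rewrite (bigD1 a) //= /t eqxx /= (negbTE dn) mul0r.
    by rewrite (bigD1 b) //= /t eqxx orbT (negbTE dn) mul0r.
  have Td : \sum_(i < y) (if (d %| i.+1)%N then s i else 0) <= T / d%:R.
    by rewrite -big_mkcond; exact: sum_coprime_weight_multiples.
  have Td0 : 0 <= \sum_(i < y) (if (d %| i.+1)%N then s i else 0).
    by apply: sumr_ge0 => i _; case: ifP.
  have ba : b != a by rewrite eq_sym.
  rewrite (bigD1 a) //= (bigD1 b) //=.
  have -> : T ^+ #|J| * (d%:R ^+ 2)^-1 = (T / d%:R) * ((T / d%:R) * \prod_(j | (j != a) && (j != b)) T).
    rewrite -prodr_const (bigD1 a) //= (bigD1 b) //=; field.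
    by rewrite pnatr_eq0 -lt0n.
  have -> : \prod_(j | (j != a) && (j != b)) \sum_(i < y) t j i =
      \prod_(j | (j != a) && (j != b)) T.
    by apply: eq_bigr => j /andP[/negbTE ja /negbTE jb]; rewrite /t ja jb.
  have Tp0 : 0 <= \prod_(j | (j != a) && (j != b)) T by apply: prodr_ge0.
  have ta : \sum_(i < y) t a i = \sum_(i < y) (if (d %| i.+1)%N then s i else 0).
    by apply: eq_bigr => i _; rewrite /t eqxx.
  have tb : \sum_(i < y) t b i = \sum_(i < y) (if (d %| i.+1)%N then s i else 0).
    by apply: eq_bigr => i _; rewrite /t eqxx orbT.
  rewrite ta tb ler_pM // ?mulr_ge0 //.
  by rewrite ler_wpM2r.
have split_bad : T ^+ #|J| <=
    \sum_(h : {ffun J -> 'I_y} | pairwise_coprime h) (\prod_j (h j).+1)%:R^-1 +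
    \sum_a \sum_(b | a != b) \sum_(P.+1 <= d < y.+1) bad a b d.
  have -> : \sum_a \sum_(b | a != b) \sum_(P.+1 <= d < y.+1) bad a b d =
      \sum_(h : {ffun J -> 'I_y}) \sum_a \sum_(b | a != b) \sum_(P.+1 <= d < y.+1)
        if (d %| (h a).+1)%N && (d %| (h b).+1)%N then \prod_j s (h j) else 0.
    rewrite [RHS]exchange_big; apply: eq_bigr => a _.
    rewrite [RHS]exchange_big; apply: eq_bigr => b _.
    rewrite [RHS]exchange_big; apply: eq_bigr => d _.
    by rewrite /bad big_mkcond.
  rewrite total [X in _ <= X + _]big_mkcond -big_split /=.
  apply: ler_sum => h _.
  have rest0 a b : 0 <= \sum_(P.+1 <= d < y.+1)
      (if (d %| (h a).+1)%N && (d %| (h b).+1)%N then \prod_j s (h j) else 0).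
    by apply: sumr_ge0 => d _; case: ifP.
  have rest0' a : 0 <= \sum_(b | a != b) \sum_(P.+1 <= d < y.+1)
      (if (d %| (h a).+1)%N && (d %| (h b).+1)%N then \prod_j s (h j) else 0).
    by apply: sumr_ge0.
  have [hc|] := ifP.
    rewrite -[leLHS]addr0 lerD ?sumr_ge0 //.
    rewrite natr_prod -prodfV; apply: ler_prod => j _; rewrite s0 /=.
    by rewrite /s /coprime_weight; case: ifP => // _; rewrite invr_ge0.
  move=> /negbT /forallPn[a /forallPn[b]]; rewrite negb_imply => /andP[ab nc].
  rewrite add0r.
  have [->|pn0] := eqVneq (\prod_j s (h j)) 0.
    by apply: sumr_ge0 => a' _; apply: sumr_ge0 => b' _; apply: sumr_ge0 => d _; case: ifP.
  (* A common prime factor of two entries serves as [d]; it exceeds [P] because the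
   entries are coprime to [P`!]. *)
pose p := pdiv (gcdn (h a).+1 (h b).+1).
  have g1 : (1 < gcdn (h a).+1 (h b).+1)%N.
    by move: nc; rewrite /coprime ltn_neqAle eq_sym => ->; rewrite gcdn_gt0.
  have pp : prime p := pdiv_prime g1.
  have [pa pb] : (p %| (h a).+1)%N /\ (p %| (h b).+1)%N.
    by split; apply: dvdn_trans (pdiv_dvd _) _; rewrite ?dvdn_gcdl ?dvdn_gcdr.
  have sa : coprime (h a).+1 P`!.
    move/prodf_neq0: pn0 => /(_ a isT); rewrite /s /coprime_weight.
    by case: ifP => //; rewrite eqxx.
  have Pp : (P < p)%N.
    rewrite ltnNge; apply/negP => pP.
    have pf : (p %| P`!)%N by rewrite dvdn_fact // prime_gt0.
    have := coprime_dvdl pa (coprime_dvdr pf sa).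
    by rewrite /coprime gcdnn => /eqP p1; move: (prime_gt1 pp); rewrite p1.
  have py : (p <= y)%N by apply: leq_trans (dvdn_leq _ pa) _ => //; exact: ltn_ord.
  rewrite [leRHS](bigD1 a) //= -[leLHS]addr0 lerD ?sumr_ge0 //.
  rewrite [leRHS](bigD1 b) //= -[leLHS]addr0 lerD ?sumr_ge0 //.
  rewrite [leRHS](big_cat_nat Pp) //=; last exact: leqW.
  rewrite -[leLHS]add0r lerD //; first by apply: sumr_ge0 => d _; case: ifP.
  rewrite big_ltn ?ltnS // pa pb /= lerDl.
  by apply: sumr_ge0 => d _; case: ifP.
rewrite -/T mulrBr mulr1 lerBlDr; apply: le_trans split_bad _; rewrite lerD2l.
apply: (@le_trans _ _ (\sum_(a : J) \sum_(b : J) T ^+ #|J| / P%:R)).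
  apply: ler_sum => a _; rewrite [leLHS]big_mkcond; apply: ler_sum => b _.
  have TJ0 : 0 <= T ^+ #|J| by rewrite exprn_ge0.
  case: ifP => ab; last by rewrite mulr_ge0 ?invr_ge0.
  apply: (@le_trans _ _ (\sum_(P.+1 <= d < y.+1) T ^+ #|J| * (d%:R ^+ 2)^-1)).
    rewrite !big_nat; apply: ler_sum => d /andP[Pd _]; apply: bad_le => //.
    by apply: leq_ltn_trans Pd.
  by rewrite -mulr_sumr ler_wpM2l // sum_inv_sqr_le.
by rewrite !sumr_const -mulrnA mulnn -[leLHS]mulr_natr -mulrA [P%:R^-1 * _]mulrC.
Qed.

Lemma harmonic_ge_ln J : ln J.+1%:R <= \sum_(j < J) j.+1%:R^-1 :> R.
Proof.
elim: J => [|J ih]; first by rewrite big_ord0 ln1.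
rewrite big_ord_recr /=; apply: le_trans _ (lerD ih (lexx _)).
have j0 : (0 : R) < J.+1%:R by rewrite ltr0n.
rewrite -lerBlDl -ln_div ?posrE ?ltr0n //.
have -> : J.+2%:R / J.+1%:R = 1 + J.+1%:R^-1 :> R.
  by rewrite -[J.+2%:R]natr1 mulrDl divff ?gt_eqF // mul1r.
apply: le_trans (le_ln1Dx _) _ => //.
by apply: lt_le_trans (_ : 0 <= _); rewrite ?ltrN10 ?invr_ge0.
Qed.

(** Already the integers congruent to 1 modulo [M] contribute this much. *)
Lemma sum_coprime_weight_ge M y : (0 < M)%N -> (M ^ 2 <= y)%N ->
  ln y%:R / (2 * M%:R) <= \sum_(i < y) coprime_weight M i.
Proof.
move=> M0 My; have M0' : (0 : R) < M%:R by rewrite ltr0n.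
have y0 : (0 < y)%N by apply: leq_trans My; rewrite expn_gt0 M0.
have y0' : (0 : R) < y%:R by rewrite ltr0n.
pose J := (y %/ M)%N.
apply: (@le_trans _ _ (\sum_(j < J) (j.+1 * M)%:R^-1)).
  have -> : \sum_(j < J) (j.+1 * M)%:R^-1 = (\sum_(j < J) j.+1%:R^-1) / M%:R :> R.
    by rewrite mulr_suml; apply: eq_bigr => j _; rewrite natrM invfM.
  rewrite invfM mulrA ler_wpM2r ?invr_ge0 //; apply: le_trans (harmonic_ge_ln J).
  have lnMy : ln M%:R <= ln y%:R / 2 :> R.
    rewrite ler_pdivlMr // mulr_natr -lnXn //.
    by rewrite ler_ln ?posrE ?exprn_gt0 // -natrX ler_nat.
  have : ln y%:R <= ln (J.+1%:R * M%:R) :> R.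
    rewrite ler_ln ?posrE ?mulr_gt0 ?ltr0n // -natrM ler_nat ltnW //.
    exact: ltn_ceil.
  by rewrite lnM ?posrE ?ltr0n //; lra.
have lt_y (j : 'I_J) : (j * M < y)%N.
  by apply: leq_trans (leq_trunc_div y M); rewrite ltn_pmul2r.
apply: (@ler_sum_inj _ _ _ _ _ (fun j => Ordinal (lt_y j))) => //.
- move=> i j _ _ [] /eqP; rewrite eqn_pmul2r // => /eqP; exact: val_inj.
- move=> j _; rewrite /coprime_weight /=.
  have -> : coprime (j * M).+1 M.
    by rewrite coprime_sym -addn1 /coprime gcdnMDl gcdn1.
  rewrite lef_pV2 ?posrE ?ltr0n ?muln_gt0 //  ler_nat mulSn addnC -addn1.
  by rewrite leq_add2l.
- by move=> i _; exact: coprime_weight_ge0.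
Qed.

End CoprimeTuples.

(** * Multiplicative energy *)

Section Energy.
Context {R : realType}.

Definition tupprod k Y (f : {ffun 'I_k -> 'I_Y}) : nat := \prod_i (f i).+1.

(** The multiplicative energy of [[1, Y]] of order [k], where each solution of
    [m_1 ... m_k = l_1 ... l_k] is weighted by the inverse of the product. *)
Definition energy k Y : R :=
  \sum_(f : {ffun 'I_k -> 'I_Y}) \sum_(g : {ffun 'I_k -> 'I_Y} | tupprod f == tupprod g)
    (tupprod f)%:R^-1.

Lemma coprime_prodl (I : finType) (P : pred I) (F : I -> nat) m :
  (forall i, P i -> coprime (F i) m) -> coprime (\prod_(i | P i) F i) m.
Proof.
move=> cF; apply: (big_ind (fun x => coprime x m)) => //; first exact: coprime1n.
by move=> a b ca cb; rewrite coprimeMl ca.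
Qed.

(** The entries of a pairwise coprime square array are the gcds of its row
    products with its column products, so such arrays inject into the solutions
    counted by [energy]. *)
Lemma energy_ge_coprime k y Y : (0 < y)%N -> (y ^ k <= Y)%N ->
  \sum_(h : {ffun 'I_k * 'I_k -> 'I_y} | pairwise_coprime h)
     (\prod_p (h p).+1)%:R^-1 <= energy k Y.
Proof.
move=> y0 yY.
have prod_le (F : 'I_k -> 'I_y) : ((\prod_i (F i).+1).-1 < Y)%N.
  have F0 : (0 < \prod_i (F i).+1)%N by rewrite prodn_gt0.
  rewrite prednK //; apply: leq_trans yY.
  by rewrite -[X in (y ^ X)%N]card_ord -prod_nat_const; apply: leq_prod.
pose row (h : {ffun 'I_k * 'I_k -> 'I_y}) : {ffun 'I_k -> 'I_Y} :=
  [ffun i => Ordinal (prod_le (fun j => h (i, j)))].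
pose col (h : {ffun 'I_k * 'I_k -> 'I_y}) : {ffun 'I_k -> 'I_Y} :=
  [ffun j => Ordinal (prod_le (fun i => h (i, j)))].
have rowE h i : (row h i).+1 = (\prod_j (h (i, j)).+1)%N.
  by rewrite ffunE /= prednK // prodn_gt0.
have colE h j : (col h j).+1 = (\prod_i (h (i, j)).+1)%N.
  by rewrite ffunE /= prednK // prodn_gt0.
have row_prod h : tupprod (row h) = (\prod_p (h p).+1)%N.
  rewrite /tupprod (eq_bigr _ (fun i _ => rowE h i)) pair_big /=.
  by apply: eq_bigr => -[].
have col_prod h : tupprod (col h) = (\prod_p (h p).+1)%N.
  rewrite /tupprod (eq_bigr _ (fun i _ => colE h i)) exchange_big pair_big /=.
  by apply: eq_bigr => -[].
have entryE h i j : pairwise_coprime h -> (h (i, j)).+1 = gcdn (row h i).+1 (col h j).+1.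
  move=> /forallP hc; rewrite rowE colE (bigD1 j) //= [X in gcdn _ X](bigD1 i) //=.
  rewrite -muln_gcdr; set b := (\prod_(_ | _) _)%N; set c := (\prod_(_ | _) _)%N.
  suff /eqP -> : coprime b c by rewrite muln1.
  apply: coprime_prodl => j' j'j; rewrite coprime_sym; apply: coprime_prodl => i' i'i.
  have /forallP/(_ (i, j'))/implyP := hc (i', j); apply.
  by rewrite xpair_eqE negb_and i'i.
rewrite /energy pair_big_dep /=.
apply: (@ler_sum_inj _ _ _ _ _ (fun h => (row h, col h))) => /=.
- move=> h h' hc hc' [rr cc]; apply/ffunP => -[i j].
  by apply: val_inj; apply: succn_inj; rewrite /= !entryE // rr cc.
- by move=> h _; rewrite row_prod col_prod.
- by move=> h _; rewrite row_prod.
- by move=> p _; rewrite invr_ge0.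
Qed.

(** The entries of the array range over the [k ^ 2] cells, each contributing a
    factor of order [ln y]. *)
Lemma energy_ge_ln k : (0 < k)%N -> exists2 c : R, 0 < c &
  exists y0 : nat, forall y Y, (y0 <= y)%N -> (y ^ k <= Y)%N ->
    c * ln y%:R ^+ (k ^ 2) <= energy k Y.
Proof.
move=> k0; pose P := (2 * (k ^ 2) ^ 2)%N.
have P0 : (0 < P)%N by rewrite muln_gt0 !expn_gt0 k0.
pose M := P`!; have M0 : (0 < M)%N := fact_gt0 P.
(* [P] is twice the square of the number of entries, so that at most half of the
   total weight is lost in [sum_pairwise_coprime]. *)
exists (2^-1 * ((2 * M%:R)^-1) ^+ (k ^ 2)).
  by rewrite mulr_gt0 ?invr_gt0 // exprn_gt0 // invr_gt0 mulr_gt0 ?ltr0n.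
exists (M ^ 2)%N => y Y My yY.
have y0 : (0 < y)%N by apply: leq_trans My; rewrite expn_gt0 M0.
apply: le_trans (energy_ge_coprime y0 yY).
have := @sum_pairwise_coprime R ('I_k * 'I_k)%type y P P0.
rewrite card_prod card_ord mulnn; apply: le_trans.
have -> : 1 - ((k ^ 2) ^ 2)%:R / P%:R = 2^-1 :> R.
  have kk : (((k ^ 2) ^ 2)%:R : R) != 0 by rewrite pnatr_eq0 -lt0n !expn_gt0 k0.
  by rewrite /P natrM invfM mulrCA divff // mulr1; lra.
rewrite -mulrA -exprMn [leRHS]mulrC ler_wpM2l // lerXn2r ?nnegrE //.
- by rewrite mulr_ge0 ?invr_ge0 ?mulr_ge0 // ln_ge0 // ler1n.
- by apply: sumr_ge0 => i _; exact: coprime_weight_ge0.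
- by rewrite mulrC; exact: sum_coprime_weight_ge.
Qed.

End Energy.

(** * Sums over residue classes *)

Section CongruenceSums.
Context {R : realType}.
Variable q : nat.
Hypothesis q_prime : prime q.
Local Notation n := q.-1.

Let q_gt0 : (0 < q)%N. Proof. exact: prime_gt0. Qed.

Definition rsqrt (m : nat) : R := (Num.sqrt m%:R)^-1.

Lemma rsqrt_ge0 m : 0 <= rsqrt m.
Proof. by rewrite invr_ge0 sqrtr_ge0. Qed.

Lemma rsqrt_le1 m : rsqrt m.+1 <= 1.
Proof.
rewrite /rsqrt invf_le1 ?sqrtr_gt0 ?ltr0n // -{1}[1]sqrtr1 ler_sqrt ?ltr0n //.
by rewrite ler1n.
Qed.

Lemma ler_rsqrt a b : (0 < a)%N -> (a <= b)%N -> rsqrt b <= rsqrt a.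
Proof.
move=> a0 ab; have b0 : (0 < b)%N := leq_trans a0 ab.
by rewrite /rsqrt lef_pV2 ?posrE ?sqrtr_gt0 ?ltr0n // ler_sqrt ?ltr0n // ler_nat.
Qed.

Lemma sum_rsqrt_le N : \sum_(0 <= i < N) rsqrt i.+1 <= 2 * Num.sqrt N%:R.
Proof.
elim: N => [|N ih]; first by rewrite big_geq // sqrtr0 mulr0.
rewrite big_nat_recr //=; apply: le_trans (lerD ih (lexx _)) _.
rewrite /rsqrt; set a := Num.sqrt N.+1%:R; set b := Num.sqrt N%:R.
have a0 : 0 < a by rewrite sqrtr_gt0 ltr0n.
have a2 : a ^+ 2 = b ^+ 2 + 1 by rewrite !sqr_sqrtr // natr1.
have b0 : 0 <= b by exact: sqrtr_ge0.
rewrite -lerBrDl -mulrBr -div1r ler_pdivrMr //.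
by have := sqr_ge0 (a - b); nra.
Qed.

(** The indicator of [(i + 1) * m = l] modulo [q] minus its average over the [n]
    invertible classes of [l], multiplied by [n]. It is the sum of
    [chi ((i + 1) * m) * conj (chi l)] over the non-principal characters. *)
Definition class_defect (m l i : nat) : R :=
  (if (i.+1 * m == l %[mod q]) then n%:R else 0) - (coprime i.+1 q)%:R.

Lemma invertible_class m l J : coprime m q -> coprime l q ->
  exists2 r, (r < q)%N & ((J * q + r).+1 * m = l %[mod q])%N.
Proof.
move=> cm cl; pose u : 'F_q := l%:R / m%:R - 1.
exists (val u).
  by have := ltn_ord u; rewrite {2}(Fp_cast q_prime).
apply/eqP; rewrite -Fp_natr_eq // natrM -natr1 natrD natrM.
have m0 : (m%:R : 'F_q) != 0 by rewrite Fp_natr_eq0 // negbK.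
have -> : (q%:R : 'F_q) = 0 by apply/eqP; rewrite (Fp_natr_eq q_prime q 0) modnn mod0n.
by rewrite mulr0 add0r natr_Zp /u subrK divfK.
Qed.

(** Each block of [q] consecutive integers contains one solution of the congruence;
    it is compared with the right end of the block, and the average with the left
    end, so that the bounds telescope over the blocks. *)
Lemma block_defect_ge m l J : (0 < J)%N -> coprime m q -> coprime l q ->
  n%:R * rsqrt (J.+1 * q) - n%:R * rsqrt (J * q) <=
  \sum_(J * q <= i < J.+1 * q) rsqrt i.+1 * class_defect m l i.
Proof.
move=> J0 cm cl; have [r rq rE] := invertible_class J cm cl.
have -> : \sum_(J * q <= i < J.+1 * q) rsqrt i.+1 * class_defect m l i =
    \sum_(i < q) rsqrt (J * q + i).+1 * class_defect m l (J * q + i).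
  rewrite -{1}[(J * q)%N]add0n mulSn big_addn addnK big_mkord.
  by apply: eq_bigr => i _; rewrite addnC.
have Jq0 : (0 < J * q)%N by rewrite muln_gt0 J0.
rewrite (eq_bigr (fun i : 'I_q =>
   rsqrt (J * q + i).+1 * (if ((J * q + i).+1 * m == l %[mod q]) then n%:R else 0) -
   rsqrt (J * q + i).+1 * (coprime (J * q + i).+1 q)%:R)); last first.
  by move=> i _; rewrite /class_defect mulrBr.
rewrite sumrB lerB //.
  rewrite (bigD1 (Ordinal rq)) //= rE eqxx -[leLHS]addr0 lerD //.
    rewrite mulrC ler_wpM2r // ler_rsqrt // mulSnr -addnS leq_add2l.
    exact: rq.
  by apply: sumr_ge0 => i _; rewrite mulr_ge0 ?rsqrt_ge0 //; case: ifP.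
have -> : n%:R * rsqrt (J * q) = \sum_(i < n) rsqrt (J * q).
  by rewrite sumr_const card_ord mulr_natl.
rewrite -(big_mkord xpredT
  (fun i => rsqrt (J * q + i).+1 * (coprime (J * q + i).+1 q)%:R)).
rewrite -[X in \sum_(0 <= _ < X) _](prednK q_gt0) big_nat_recr //= big_mkord -[leRHS]addr0 lerD //.
  apply: ler_sum => i _; rewrite -[leRHS]mulr1 ler_pM ?rsqrt_ge0 //.
    by rewrite ler_rsqrt // leqW // leq_addr.
  by rewrite lern1 leq_b1.
have -> : coprime (J * q + n).+1 q = false.
  rewrite -addnS prednK // -mulSnr coprime_sym prime_coprime //.
  by rewrite dvdn_mull.
by rewrite mulr0.
Qed.

(** In the first block only the true solutions with [i < Y] are kept, and the
    average costs at most [2 * sqrt q]; the remaining blocks telescope to at least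
    [- sqrt q], however many they are. *)
Lemma class_defect_sum_ge m l J Y : (0 < J)%N -> (Y <= q)%N ->
  coprime m q -> coprime l q ->
  n%:R * (\sum_(0 <= i < Y | (i.+1 * m == l)%N) rsqrt i.+1) - 3 * Num.sqrt q%:R <=
  \sum_(0 <= i < J * q) rsqrt i.+1 * class_defect m l i.
Proof.
move=> J0 Yq cm cl; set diag := n%:R * _.
have q0 : (0 : R) < q%:R by rewrite ltr0n.
suff : diag - 2 * Num.sqrt q%:R - n%:R * rsqrt q + n%:R * rsqrt (J * q) <=
    \sum_(0 <= i < J * q) rsqrt i.+1 * class_defect m l i.
  apply: le_trans; have : n%:R * rsqrt q <= Num.sqrt q%:R.
    rewrite /rsqrt ler_pdivrMr ?sqrtr_gt0 // -expr2 sqr_sqrtr; last exact: ltW.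
    by rewrite ler_nat leq_pred.
  have : 0 <= n%:R * rsqrt (J * q) by rewrite mulr_ge0 // rsqrt_ge0.
  by move: (n%:R * rsqrt (J * q)) (n%:R * rsqrt q) => u v; lra.
case: J J0 => // J _; elim: J => [|J ih].
  rewrite mul1n subrK.
  rewrite (eq_bigr (fun i =>
     rsqrt i.+1 * (if (i.+1 * m == l %[mod q]) then n%:R else 0) -
     rsqrt i.+1 * (coprime i.+1 q)%:R)); last first.
    by move=> i _; rewrite /class_defect mulrBr.
  rewrite sumrB lerB //.
    rewrite /diag (big_cat_nat (leq0n Y) Yq) /= -[leLHS]addr0 lerD //.
      rewrite big_mkcond mulr_sumr; apply: ler_sum => i _.
      case: ifP => [/eqP ->|_]; first by rewrite eqxx mulrC.
      by rewrite mulr0 mulr_ge0 ?rsqrt_ge0 //; case: ifP.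
    by apply: sumr_ge0 => i _; rewrite mulr_ge0 ?rsqrt_ge0 //; case: ifP.
  apply: le_trans (sum_rsqrt_le q); apply: ler_sum => i _.
  by rewrite -[leRHS]mulr1 ler_wpM2l ?rsqrt_ge0 // lern1 leq_b1.
rewrite (big_cat_nat (leq0n (J.+1 * q)) (leq_mul (leqnSn J.+1) (leqnn q))) /=.
apply: le_trans (lerD ih (@block_defect_ge m l J.+1 isT cm cl)).
rewrite le_eqVlt; apply/orP; left; apply/eqP.
by move: (n%:R * rsqrt (J.+2 * q)) (n%:R * rsqrt (J.+1 * q)) => u v; ring.
Qed.

End CongruenceSums.

(** * Moments over the characters *)

Section CharacterMoments.
Context {R : realType}.
Variable q : nat.
Hypothesis q_prime : prime q.
Local Notation C := (Cplx R).
Local Notation n := q.-1.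
Variables (g : 'F_q) (z : C).
Hypotheses (gP : n.-primitive_root g) (zP : n.-primitive_root z).
Local Notation chi := (power_char g z).
Local Notation rsqrt := (@rsqrt R).

Let q_gt0 : (0 < q)%N. Proof. exact: prime_gt0. Qed.
Let n_gt0 : (0 < n)%N. Proof. by case: q (prime_gt1 q_prime) => [|[]]. Qed.

Lemma power_charM j a b : chi j (a * b)%N = chi j a * chi j b.
Proof. by have [_ ->] := power_charP q_prime gP zP j. Qed.

Lemma power_char1 j : chi j 1%N = 1.
Proof.
have [_ _ c0] := power_charP q_prime gP zP j.
have c1 : chi j 1%N != 0 by rewrite c0 coprime1n.
by apply: (mulfI c1); rewrite -power_charM mulr1.
Qed.

Lemma power_char_prod j (I : finType) (F : I -> nat) :
  chi j (\prod_i F i)%N = \prod_i chi j (F i).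
Proof. exact: (big_morph (chi j) (power_charM j) (power_char1 j)). Qed.

Lemma power_char_noncoprime j a : ~~ coprime a q -> chi j a = 0.
Proof.
have [_ _ c0] := power_charP q_prime gP zP j.
by rewrite -c0 negbK => /eqP.
Qed.

Lemma power_char0E a : chi 0 a = (coprime a q)%:R.
Proof. by rewrite -principal_charE. Qed.

Lemma conj_realM (x : R) (w : C) : Num.conj (x%:C * w) = x%:C * Num.conj w.
Proof. by rewrite rmorphM; congr (_ * _); exact: conjc_real. Qed.

Lemma cmod_Num_conj (w : C) : cmod (Num.conj w) = cmod w.
Proof. exact: cmod_conj. Qed.

Lemma mul_conj_cmod (w : C) : w * Num.conj w = (cmod w ^+ 2)%:C.
Proof. by have := sqr_normc w; rewrite normrE_cmod -rmorphXn => ->. Qed.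

(** Both sides vanish when [a] is not coprime to [q]. *)
Lemma power_char_orthogonality_real a b : coprime b q ->
  \sum_(j < n) chi j a * Num.conj (chi j b) =
  (if a == b %[mod q] then n%:R else 0 : R)%:C.
Proof.
move=> cb; have [ca|nca] := boolP (coprime a q).
  rewrite power_char_orthogonality //; case: ifP => _ //.
  by rewrite -natrC.
rewrite big1 => [|j _]; last by rewrite power_char_noncoprime // mul0r.
case: ifP => // /eqP ab; case/negP: nca.
by rewrite -coprime_modl ab coprime_modl.
Qed.

Lemma nonprincipal_orthogonality a b : coprime b q ->
  \sum_(j < n | j != 0%N :> nat) chi j a * Num.conj (chi j b) =
  ((if a == b %[mod q] then n%:R else 0) - (coprime a q)%:R : R)%:C.
Proof.
move=> cb; have := power_char_orthogonality_real a cb.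
rewrite (bigD1 (Ordinal n_gt0)) //= !power_char0E cb rmorph1 mulr1 => H.
rewrite rmorphB rmorph_nat /= -H addrAC subrr add0r.
by apply: eq_bigl => j; rewrite -val_eqE.
Qed.

Lemma sum_dirichlet_polys (P : pred 'I_n) (U V : finType) (al : U -> R) (a : U -> nat)
    (be : V -> R) (b : V -> nat) (K : nat -> nat -> R) :
  (forall u v, \sum_(j < n | P j) chi j (a u) * Num.conj (chi j (b v)) = (K (a u) (b v))%:C) ->
  \sum_(j < n | P j) (\sum_u (al u)%:C * chi j (a u)) *
     Num.conj (\sum_v (be v)%:C * chi j (b v)) =
  (\sum_u \sum_v al u * be v * K (a u) (b v))%:C.
Proof.
move=> KE.
under eq_bigr do rewrite rmorph_sum /= big_distrlr /=.
rewrite exchange_big rmorph_sum /=; apply: eq_bigr => u _.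
rewrite exchange_big rmorph_sum /=; apply: eq_bigr => v _.
rewrite rmorphM /= -KE mulr_sumr; apply: eq_bigr => j _.
by rewrite conj_realM rmorphM mulrACA.
Qed.

Variables (k' Y : nat).
Local Notation k := k'.+1.
Hypothesis Y_gt0 : (0 < Y)%N.
Hypothesis Yk_lt : (Y ^ k < q)%N.

Let Yq : (Y < q)%N.
Proof. by apply: leq_ltn_trans Yk_lt; rewrite -{1}[Y]expn1 leq_pexp2l. Qed.

(** The resonator: its powers single out products of integers up to [Y]. *)
Definition short_sum (j : nat) : C := \sum_(i < Y) (rsqrt i.+1)%:C * chi j i.+1.

Definition tupweight m (f : {ffun 'I_m -> 'I_Y}) : R := \prod_i rsqrt (f i).+1.

Lemma tupweight_ge0 m (f : {ffun 'I_m -> 'I_Y}) : 0 <= tupweight f.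
Proof. by apply: prodr_ge0 => i _; exact: rsqrt_ge0. Qed.

Lemma tupweight_le1 m (f : {ffun 'I_m -> 'I_Y}) : tupweight f <= 1.
Proof.
suff /andP[] : 0 <= tupweight f <= 1 by [].
apply: (big_ind (fun x => 0 <= x <= 1)) => [|x y|i _].
- by rewrite ler01 lexx.
- by move=> /andP[x0 x1] /andP[y0 y1]; rewrite mulr_ge0 // mulr_ile1.
- by rewrite rsqrt_ge0 rsqrt_le1.
Qed.

Lemma tupweightE m (f : {ffun 'I_m -> 'I_Y}) : tupweight f = rsqrt (tupprod f).
Proof.
rewrite /tupweight /tupprod; apply: (big_ind2 (fun x y => x = rsqrt y)) => //.
- by rewrite /rsqrt sqrtr1 invr1.
- by move=> _ a _ b -> ->; rewrite /rsqrt natrM sqrtrM // invfM.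
Qed.

Lemma tupprod_le m (f : {ffun 'I_m -> 'I_Y}) : (tupprod f <= Y ^ m)%N.
Proof.
rewrite -[X in (Y ^ X)%N](card_ord m) -prod_nat_const.
by apply: leq_prod => i _; exact: ltn_ord.
Qed.

Lemma coprime_small i : (0 < i)%N -> (i < q)%N -> coprime i q.
Proof.
by move=> i0 iq; rewrite coprime_sym prime_coprime // gtnNdvd.
Qed.

Lemma coprime_tupprod m (f : {ffun 'I_m -> 'I_Y}) : coprime (tupprod f) q.
Proof.
apply: coprime_prodl => i _; apply: coprime_small => //.
exact: leq_ltn_trans (ltn_ord _) Yq.
Qed.

Lemma short_sumX m j : short_sum j ^+ m =
  \sum_(f : {ffun 'I_m -> 'I_Y}) (tupweight f)%:C * chi j (tupprod f).
Proof.
rewrite -[X in _ ^+ X](card_ord m) -prodr_const bigA_distr_bigA /=.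
apply: eq_bigr => f _; rewrite big_split /= rmorph_prod; congr (_ * _).
by rewrite /tupprod power_char_prod.
Qed.

Lemma short_sum_cmod j : (cmod (short_sum j) ^+ (2 * k))%:C =
  short_sum j ^+ k * Num.conj (short_sum j ^+ k).
Proof. by rewrite mul_conj_cmod cmodX -exprM mulnC. Qed.

Lemma short_moment : \sum_(j < n) cmod (short_sum j) ^+ (2 * k) = n%:R * energy k Y.
Proof.
apply: complexI; rewrite rmorph_sum /=.
under eq_bigr do rewrite short_sum_cmod !short_sumX.
rewrite (@sum_dirichlet_polys xpredT _ _ _ _ _ _
   (fun a b => if a == b %[mod q] then n%:R else 0)); last first.
  by move=> f f'; rewrite power_char_orthogonality_real // coprime_tupprod.
congr (_%:C); rewrite mulr_sumr; apply: eq_bigr => f _.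
rewrite mulr_sumr [RHS]big_mkcond; apply: eq_bigr => f' _.
have lt_q (h : {ffun 'I_k -> 'I_Y}) : (tupprod h < q)%N.
  exact: leq_ltn_trans (tupprod_le h) Yk_lt.
rewrite !modn_small //; case: eqP => [ff'|_]; last by rewrite mulr0.
rewrite !tupweightE -ff' mulrC /rsqrt -invfM -expr2 sqr_sqrtr //.
Qed.

(** The same moment with one factor of the resonator singled out; in this form it
    is the diagonal part of the moment of [long_sum]. *)
Lemma short_moment_mixed :
  n%:R * energy k Y =
  \sum_(f : {ffun 'I_k' -> 'I_Y}) \sum_(f' : {ffun 'I_k -> 'I_Y})
    tupweight f * tupweight f' *
    (n%:R * \sum_(0 <= i < Y | (i.+1 * tupprod f == tupprod f')%N) rsqrt i.+1).
Proof.
rewrite -short_moment; apply: complexI; rewrite rmorph_sum /=.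
under eq_bigr do rewrite short_sum_cmod {1}exprS
  [X in _ * X * _]short_sumX [X in _ * Num.conj X]short_sumX.
have prodE (j : 'I_n) : short_sum j * (\sum_(f : {ffun 'I_k' -> 'I_Y}) (tupweight f)%:C * chi j (tupprod f)) =
  \sum_(u : 'I_Y * {ffun 'I_k' -> 'I_Y}) (rsqrt u.1.+1 * tupweight u.2)%:C * chi j (u.1.+1 * tupprod u.2)%N.
  rewrite /short_sum big_distrlr pair_big /=; apply: eq_bigr => -[i f] _ /=.
  by rewrite power_charM rmorphM mulrACA.
under eq_bigr do rewrite prodE.
rewrite (@sum_dirichlet_polys xpredT _ _ _ _ _ _
   (fun a b => if a == b %[mod q] then n%:R else 0)); last first.
  by move=> u f'; rewrite power_char_orthogonality_real // coprime_tupprod.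
congr (_%:C).
rewrite -(pair_big xpredT xpredT (fun (i : 'I_Y) (f : {ffun 'I_k' -> 'I_Y}) =>
   \sum_(f' : {ffun 'I_k -> 'I_Y}) rsqrt i.+1 * tupweight f * tupweight f' *
   (if (i.+1 * tupprod f == tupprod f' %[mod q]) then n%:R else 0))) /=.
rewrite exchange_big; apply: eq_bigr => f _; rewrite exchange_big.
apply: eq_bigr => f' _; rewrite big_mkord [in RHS]big_mkcond !mulr_sumr.
apply: eq_bigr => i _.
have -> : (i.+1 * tupprod f == tupprod f' %[mod q]) = (i.+1 * tupprod f == tupprod f')%N.
  rewrite !modn_small //.
    exact: leq_ltn_trans (tupprod_le f') Yk_lt.
  apply: leq_ltn_trans Yk_lt; rewrite expnS leq_mul ?tupprod_le //.
by case: ifP => _; [ring | rewrite !mulr0].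
Qed.

Definition long_sum (J j : nat) : C :=
  series (fun i => chi j i.+1 * npowN i.+1 (2^-1 : R)%:C) (J * q).

Lemma long_sumE J j : long_sum J j = \sum_(i < J * q) (rsqrt i.+1)%:C * chi j i.+1.
Proof.
rewrite /long_sum /series /= big_mkord; apply: eq_bigr => i _.
by rewrite npowN_half mulrC.
Qed.

(** All weights are non-negative, so [class_defect_sum_ge] can be applied to each
    pair of tuples; as the weights are at most 1, the errors add up to at most
    the number of pairs. *)
Lemma long_moment_ge J : (0 < J)%N ->
  n%:R * energy k Y - 3 * Num.sqrt q%:R * (Y ^ (k' + k))%:R <=
  complex.Re (\sum_(j < n | j != 0%N :> nat)
    long_sum J j * short_sum j ^+ k' * Num.conj (short_sum j ^+ k)).
Proof.
move=> J0.
under eq_bigr do rewrite !short_sumX long_sumE.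
have prodE (j : 'I_n) : (\sum_(i < J * q) (rsqrt i.+1)%:C * chi j i.+1) *
    (\sum_(f : {ffun 'I_k' -> 'I_Y}) (tupweight f)%:C * chi j (tupprod f)) =
  \sum_(u : 'I_(J * q) * {ffun 'I_k' -> 'I_Y}) (rsqrt u.1.+1 * tupweight u.2)%:C * chi j (u.1.+1 * tupprod u.2)%N.
  rewrite big_distrlr pair_big /=; apply: eq_bigr => -[i f] _ /=.
  by rewrite power_charM rmorphM mulrACA.
under eq_bigr do rewrite prodE.
rewrite (@sum_dirichlet_polys (fun j : 'I_n => j != 0%N :> nat) _ _ _ _ _ _
   (fun a b => (if a == b %[mod q] then n%:R else 0) - (coprime a q)%:R)); last first.
  by move=> u f'; rewrite nonprincipal_orthogonality // coprime_tupprod.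
rewrite /= -(pair_big xpredT xpredT (fun (i : 'I_(J * q)) (f : {ffun 'I_k' -> 'I_Y}) =>
   \sum_(f' : {ffun 'I_k -> 'I_Y}) rsqrt i.+1 * tupweight f * tupweight f' *
   ((if (i.+1 * tupprod f == tupprod f' %[mod q]) then n%:R else 0) -
    (coprime (i.+1 * tupprod f) q)%:R))) /=.
rewrite exchange_big /= short_moment_mixed.
have -> : (Y ^ (k' + k))%:R = \sum_(f : {ffun 'I_k' -> 'I_Y}) \sum_(f' : {ffun 'I_k -> 'I_Y}) 1 :> R.
  by rewrite !sumr_const -mulrnA !card_ffun !card_ord -expnD addnC.
rewrite mulr_sumr -sumrB; apply: ler_sum => f _.
rewrite exchange_big mulr_sumr -sumrB; apply: ler_sum => f' _.
have w0 : 0 <= tupweight f * tupweight f' by rewrite mulr_ge0 ?tupweight_ge0.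
have w1 : tupweight f * tupweight f' <= 1.
  by rewrite mulr_ile1 ?tupweight_ge0 ?tupweight_le1.
have := @class_defect_sum_ge R q q_prime _ _ J Y J0 (ltnW Yq) (coprime_tupprod f) (coprime_tupprod f').
move=> /(ler_wpM2l w0); rewrite mulrBr !big_mkord => H.
apply: (@le_trans _ _ (tupweight f * tupweight f' *
  \sum_(i < J * q) rsqrt i.+1 * class_defect q (tupprod f) (tupprod f') i)).
  apply: le_trans H; rewrite lerB // mulr1 ler_piMl // mulr_ge0 // sqrtr_ge0.
rewrite mulr_sumr le_eqVlt; apply/orP; left; apply/eqP; apply: eq_bigr => i _.
by rewrite /class_defect coprimeMl coprime_tupprod andbT mulrCA !mulrA.
Qed.

Lemma muln_cvgny : (fun J => J * q)%N @ \oo --> \oo.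
Proof.
move=> A [N _ NA]; exists N => // J NJ; apply: NA; rewrite /=.
by apply: leq_trans NJ _; rewrite leq_pmulr.
Qed.

Lemma mixed_moment_ge :
  n%:R * energy k Y - 3 * Num.sqrt q%:R * (Y ^ (k' + k))%:R <=
  \sum_(j < n | j != 0%N :> nat)
    cmod (dirichletL (chi j) (2^-1 : R)%:C) * cmod (short_sum j) ^+ (k' + k).
Proof.
pose L j := dirichletL (chi j) (2^-1 : R)%:C.
have cvL (j : 'I_n) : j != 0%N :> nat -> (fun J => long_sum J j) @ \oo --> (L j : C).
  move=> j0; have h2 : 0 < complex.Re ((2^-1 : R)%:C : C) by rewrite /= invr_gt0.
  have := dirichletL_cvg q_gt0 (power_char_mean_zero q_prime gP zP j0) h2.
  by apply: cvg_comp; exact: muln_cvgny.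
pose rest (j : nat) : C := short_sum j ^+ k' * Num.conj (short_sum j ^+ k).
have cvS : (fun J => \sum_(j < n | j != 0%N :> nat) long_sum J j * rest j) @ \oo -->
   (\sum_(j < n | j != 0%N :> nat) L j * rest j : C).
  apply: ccvg_sum => j j0; under eq_fun do rewrite mulrC.
  by rewrite mulrC; apply: ccvgMr; exact: cvL.
apply: (@le_trans _ _ (complex.Re (\sum_(j < n | j != 0%N :> nat) L j * rest j : C))).
  apply: (ler_cvg_to (cvg_cst _) (ccvg_Re cvS)).
  exists 1%N => // J /= J0; apply: le_trans (long_moment_ge J0) _.
  rewrite le_eqVlt; apply/orP; left; apply/eqP; congr complex.Re.
  by apply: eq_bigr => j _; rewrite /rest mulrA.
rewrite Re_sum; apply: ler_sum => j _.
apply: le_trans (ler_norm _) _; apply: le_trans (Re_le_cmod _) _.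
by rewrite /rest !cmodM cmod_Num_conj !cmodX -exprD.
Qed.

End CharacterMoments.

(** * The lower bound for the moment *)

Section MomentInequality.
Context {R : realType}.

(** A weighted form of Young's inequality: either [a <= b / 4], or [b <= 4 * a]. *)
Lemma mul_exp_le (a b : R) m : 0 <= a -> 0 <= b ->
  a * b ^+ m <= 4 ^+ m * a ^+ m.+1 + b ^+ m.+1 / 4.
Proof.
move=> a0 b0; have [ab|ba] := leP a (b / 4).
  apply: (@le_trans _ _ (b ^+ m.+1 / 4)).
    by rewrite exprS mulrAC ler_wpM2r ?exprn_ge0.
  by rewrite lerDr mulr_ge0 ?exprn_ge0.
apply: (@le_trans _ _ (4 ^+ m * a ^+ m.+1)); last first.
  by rewrite lerDl mulr_ge0 ?exprn_ge0 ?invr_ge0.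
rewrite exprS mulrCA ler_wpM2l // -exprMn lerXn2r ?nnegrE ?mulr_ge0 //.
by rewrite ltW // mulrC -ltr_pdivrMr.
Qed.

Lemma energy_ge1 k Y : (0 < Y)%N -> 1 <= energy k Y :> R.
Proof.
case: Y => // Y _; pose f : {ffun 'I_k -> 'I_Y.+1} := [ffun=> ord0].
have f1 : tupprod f = 1%N by rewrite /tupprod big1 // => i _; rewrite ffunE.
have t0 (h : {ffun 'I_k -> 'I_Y.+1}) : 0 <= (tupprod h)%:R^-1 :> R by rewrite invr_ge0.
rewrite /energy (bigD1 f) //= (bigD1 f) //= f1 invr1 -addrA lerDl addr_ge0 //.
  by apply: sumr_ge0 => h _.
by apply: sumr_ge0 => h _; apply: sumr_ge0.
Qed.

(** [mul_exp_le] with [a] the central value and [b] the resonator bounds the mixed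
    moment by the moment and a quarter of the moment of the resonator, which is
    itself at most the mixed moment up to the error. *)
Lemma moment_ge_energy (q k' Y : nat) : prime q -> (48 <= Y)%N ->
  (Y ^ (8 * k'.+1) <= q)%N ->
  q%:R * energy k'.+1 Y / 4 <= 4 ^+ (2 * k').+1 *
    \sum_(chi \in (dirichlet_char R q `\ principal_char R q)%classic)
       cmod (dirichletL chi (2^-1 : R)%:C) ^+ (2 * k'.+1) :> R.
Proof.
move=> q_prime Y48 Yq; set k := k'.+1.
have [g gP] := primitive_root_Fp q_prime.
have n_gt0 : (0 < q.-1)%N by rewrite ltn_predRL prime_gt1.
have [z zP] := @primitive_root_C R q.-1 n_gt0.
have Y0 : (0 < Y)%N by apply: leq_trans Y48.
have Y1 : (1 < Y)%N by apply: leq_trans Y48.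
have Yk_lt : (Y ^ k < q)%N.
  by apply: leq_trans Yq; rewrite ltn_exp2l // /k; lia.
rewrite (nonprincipal_sumE q_prime gP zP).
set M := \sum_(j < q.-1 | _) _.
have main := @mixed_moment_ge R q q_prime g z gP zP k' Y Y0 Yk_lt.
have := short_moment q_prime gP zP Y0 Yk_lt; rewrite -/k => short.
set E := energy k Y in main short *.
have E1 : 1 <= E := energy_ge1 k Y0.
have upper : \sum_(j < q.-1 | j != 0%N :> nat)
    cmod (dirichletL (power_char g z j) (2^-1 : R)%:C) * cmod (short_sum g z Y j) ^+ (k' + k)
    <= 4 ^+ (2 * k').+1 * M + (q.-1)%:R * E / 4.
  apply: (@le_trans _ _ (\sum_(j < q.-1 | j != 0%N :> nat)
    (4 ^+ (2 * k').+1 * cmod (dirichletL (power_char g z j) (2^-1 : R)%:C) ^+ (2 * k) +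
     cmod (short_sum g z Y j) ^+ (2 * k) / 4))).
    apply: ler_sum => j _.
    have -> : (k' + k = (2 * k').+1)%N by rewrite /k; lia.
    have -> : (2 * k = (2 * k').+2)%N by rewrite /k; lia.
    exact: mul_exp_le (cmod_ge0 _) (cmod_ge0 _).
  rewrite big_split /= -mulr_sumr lerD2l -mulr_suml ler_wpM2r //.
  rewrite -short [leRHS](bigID (fun j : 'I_q.-1 => j != 0%N :> nat)) /= lerDl.
  by apply: sumr_ge0 => j _; rewrite exprn_ge0 // cmod_ge0.
have q0 : (0 : R) < q%:R by rewrite ltr0n prime_gt0.
(* [Y ^ (2 * k)] is at most [sqrt q], and exceeds the number of pairs of tuples by
   the factor [Y], at least 48; so the error is at most [3 / 48] of [q]. *)
have err : 3 * Num.sqrt q%:R * (Y ^ (k' + k))%:R <= q%:R / 16 :> R.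
  have s0 : 0 <= Num.sqrt q%:R :> R by exact: sqrtr_ge0.
  have s2 : Num.sqrt q%:R * Num.sqrt q%:R = q%:R :> R by rewrite -expr2 sqr_sqrtr ?ltW.
  suff : 48 * (Y ^ (k' + k))%:R <= Num.sqrt q%:R :> R.
    have key (S W Q : R) : 0 <= S -> S * S = Q -> 48 * W <= S -> 3 * S * W <= Q / 16.
      by move=> S0 <- SW; nra.
    exact: key.
  apply: (@le_trans _ _ ((Y ^ (2 * k))%:R)).
    rewrite -natrM ler_nat; have -> : (2 * k = (k' + k).+1)%N by rewrite /k; lia.
    by rewrite expnS leq_mul2r Y48 orbT.
  rewrite -[leLHS]ger0_norm // -sqrtr_sqr ler_sqrt // -natrX ler_nat -expnM.
  apply: leq_trans Yq; rewrite leq_exp2l // /k; lia.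
have n2 : q%:R / 2 <= (q.-1)%:R :> R.
  rewrite ler_pdivrMr // -natrM ler_nat.
  by have := prime_gt1 q_prime; lia.
have := le_trans main upper.
move: (4 ^+ (2 * k').+1 * M) (3 * _ * _) err (q.-1)%:R n2 => X e err N n2.
by nra.
Qed.

End MomentInequality.

Theorem mainTheorem1 (R : realType) (k : nat) (hk : (1 <= k)%N) :
  exists (c : R) (q0 : nat), 0 < c /\
    forall q : nat, prime q -> (q0 <= q)%N ->
      c * q%:R * ln q%:R ^+ (k ^ 2) <=
      \sum_(chi \in dirichlet_char R q `\ principal_char R q)
         cmod (dirichletL chi (2^-1 : R)%:C) ^+ (2 * k).
Proof.
have [c c0 [y0 energyP]] := @energy_ge_ln R k hk.
pose D := (8 * k ^ 2)%N; have D0 : (0 < D)%N by rewrite muln_gt0 expn_gt0 hk.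
pose m := (2 * k.-1).+1; pose y1 := maxn y0 48.
(* [y] will be the largest integer with [y ^ D <= q], and [Y = y ^ k]; then
   [q < (y + 1) ^ D <= y ^ (2 * D)], so [ln y >= ln q / (2 * D)]. *)
exists (c / 4 * (2 * D)%:R ^- (k ^ 2) / 4 ^+ m), (y1 ^ D)%N.
have D0' : (0 : R) < (2 * D)%:R by rewrite ltr0n muln_gt0.
split; first by rewrite !mulr_gt0 ?invr_gt0 ?exprn_gt0.
move=> q q_prime q_ge.
have exy : exists y, (y ^ D <= q)%N by exists y1.
have bound y : (y ^ D <= q)%N -> (y <= q)%N.
  by apply: leq_trans; case: y => // y; rewrite -{1}[y.+1]expn1 leq_pexp2l.
have [y yq ymax] := ex_maxnP exy bound.
have y1y : (y1 <= y)%N := ymax _ q_ge.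
have [y0y y48] : (y0 <= y)%N /\ (48 <= y)%N by move: y1y; rewrite geq_max => /andP.
have y_gt0 : (0 < y)%N by apply: leq_trans y48.
have Y48 : (48 <= y ^ k)%N.
  by apply: leq_trans y48 _; rewrite -{1}[y]expn1 leq_pexp2l.
have Yq : ((y ^ k) ^ (8 * k.-1.+1) <= q)%N.
  rewrite prednK // -expnM; apply: leq_trans yq; rewrite /D leq_pexp2l //; lia.
have := @moment_ge_energy R q k.-1 (y ^ k)%N q_prime Y48 Yq.
rewrite prednK // -/m; set S := \sum_(_ \in _) _ => main.
have lny : ln q%:R <= (2 * D)%:R * ln y%:R :> R.
  rewrite mulr_natl -lnXn ?ltr0n // ler_ln ?posrE ?exprn_gt0 ?ltr0n ?y_gt0 ?(prime_gt0 q_prime) //.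
  rewrite -natrX ler_nat ltnW // ltnNge; apply/negP => yy.
  have : (y.+1 ^ D <= q)%N.
    apply: leq_trans yy; rewrite expnM leq_exp2r //.
    by rewrite -mulnn; apply: (@leq_trans (2 * y)); [lia | rewrite leq_mul2r; lia].
  by move/ymax; rewrite ltnn.
have lnq0 : 0 <= ln q%:R :> R by rewrite ln_ge0 // ler1n prime_gt0.
have low : c * (ln q%:R / (2 * D)%:R) ^+ (k ^ 2) <= energy k (y ^ k).
  apply: le_trans (energyP y (y ^ k)%N y0y (leqnn _)).
  rewrite ler_wpM2l ?(ltW c0) // lerXn2r ?nnegrE ?divr_ge0 ?ln_ge0 ?ler1n ?(prime_gt0 q_prime) //.
  by rewrite ler_pdivrMr // mulrC.
have -> : c / 4 / (2 * D)%:R ^+ (k ^ 2) / 4 ^+ m * q%:R * ln q%:R ^+ (k ^ 2) =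
    q%:R * (c * (ln q%:R / (2 * D)%:R) ^+ (k ^ 2)) / 4 / 4 ^+ m.
  by rewrite expr_div_n; ring.
rewrite ler_pdivrMr ?exprn_gt0 // [leRHS]mulrC; apply: le_trans main.
by rewrite ler_wpM2r // ler_wpM2l.
Qed.
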